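(* Let $n,m\ge 2$ and let $NI(G^2)\subset S=K[V(G)]$ be the closed neighborhood ideal of the square of the broom graph $G=B(n,m)$ on the vertex set $V(G)=\{x_1,\ldots,x_n,y_1,\ldots,y_m\}$. Then $NI(G^2)$ is Cohen--Macaulay if and only if $m\in\{2,5\}$.
   Context: $K$ is a field. For $n,m\ge 2$, the broom graph $G=B(n,m)$ is the simple graph with vertex set $V(G)=\{x_1,\ldots,x_n,y_1,\ldots,y_m\}$ and edge set $E(G)=\{\{x_i,y_1\}:1\le i\le n\}\cup\{\{y_j,y_{j+1}\}:1\le j\le m-1\}$. Its square $G^2$ is the graph on the same vertex set with edge set $E(G^2)=E(G)\cup\{\{x_i,x_j\}:1\le i<j\le n\}\cup\{\{x_i,y_2\}:1\le i\le n\}\cup\{\{y_j,y_{j+2}\}:1\le j\le m-2\}$. For a simple graph $H$ and a vertex $u$, the closed neighborhood is $N[u]=\{u\}\cup\{v:\{u,v\}\in E(H)\}$. The closed neighborhood ideal $NI(H)$ is the squarefree monomial ideal of the polynomial ring $K[V(H)]$ (whose variables are the vertices) generated by the monomials $\prod_{v\in N[u]}v$, for $u\in V(H)$. An ideal $I\subset S$ is called Cohen--Macaulay if the quotient ring $S/I$ is Cohen--Macaulay. *)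

(* Defs.v *)
From HB Require Import structures.
From mathcomp Require Import all_boot all_order all_algebra.
From mathcomp Require Import generic_quotient ring_quotient.
From mathcomp Require Import boolp.
From mathcomp Require Import ring zify.
From mathcomp Require Import mpoly.

Set Implicit Arguments.
Unset Strict Implicit.
Unset Printing Implicit Defensive.

Import GRing.Theory.
Local Open Scope ring_scope.
Local Open Scope quotient_scope.

(* The library's [idealr] predicates are boolean, so membership in a generated
   ideal is decided classically by [asbool]. *)
Definition ideal_gen (R : comNzRingType) (s : seq R) : {pred R} :=
  fun x => `[< exists c : nat -> R, x = \sum_(i < size s) c i * s`_i >].

Lemma ideal_gen_lin (R : comNzRingType) (s : seq R) (a u v : R) :
  u \in ideal_gen s -> v \in ideal_gen s -> a * u + v \in ideal_gen s.
Proof.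
move=> /asboolP[c ->] /asboolP[d ->]; apply/asboolP.
exists (fun i => a * c i + d i); rewrite mulr_sumr -big_split.
by apply: eq_bigr => i _; rewrite mulrDl mulrA.
Qed.

Lemma ideal_gen0 (R : comNzRingType) (s : seq R) : 0 \in ideal_gen s.
Proof. by apply/asboolP; exists (fun=> 0); rewrite big1 // => i _; rewrite mul0r. Qed.

(* The inhabitants of [idealr R] and [prime_idealr R] are proper ideals. *)
Definition maximal_ideal (R : comNzRingType) (M : idealr R) : Prop :=
  forall J : idealr R, {subset M <= J} -> {subset J <= M}.

Definition noetherian (R : comNzRingType) : Prop :=
  forall I : idealr R, exists s : seq R, I =i ideal_gen s.

Module Loc.
Section Loc.
Variables (R : comNzRingType) (P : prime_idealr R).

Definition den := {s : R | s \notin (P : pred R)}.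

Lemma den1_subproof : 1 \notin (P : pred R).
Proof. by rewrite idealr1. Qed.

Lemma denM_subproof (s t : den) : val s * val t \notin (P : pred R).
Proof. by rewrite prime_idealrM negb_or (valP s) (valP t). Qed.

Definition den1 : den := Sub 1 den1_subproof.
Definition denM (s t : den) : den := Sub (val s * val t) (denM_subproof s t).

Definition denv (s : den) : R := val s.

Lemma denv1 : denv den1 = 1. Proof. by []. Qed.

Lemma denvM (s t : den) : denv (denM s t) = denv s * denv t.
Proof. by []. Qed.

(* [(a, s)] stands for the fraction a / s. *)
Definition frac := (R * den)%type.

Definition equiv (x y : frac) : bool :=
  `[< exists u : den,
        denv u * (x.1 * denv y.2) = denv u * (y.1 * denv x.2) >].

Lemma equivP (x y : frac) :
  reflect (exists u : den, denv u * (x.1 * denv y.2) = denv u * (y.1 * denv x.2))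
          (equiv x y).
Proof. exact: asboolP. Qed.

Lemma equiv_is_equiv : equiv_class_of equiv.
Proof.
split=> [x|x y|y x z].
- by apply/equivP; exists den1.
- by apply/equivP/equivP => -[u e]; exists u; rewrite e.
move=> /equivP[u e] /equivP[v f]; apply/equivP.
exists (denM (denM u v) y.2); rewrite !denvM.
transitivity (denv v * denv z.2 * (denv u * (x.1 * denv y.2))); first by ring.
rewrite e; transitivity (denv u * denv x.2 * (denv v * (y.1 * denv z.2))); first by ring.
by rewrite f; ring.
Qed.

Canonical equiv_equivRel := EquivRelPack equiv_is_equiv.
Canonical equiv_encModRel := defaultEncModRel equiv.

Definition type := {eq_quot equiv}.
#[export]
HB.instance Definition _ : EqQuotient _ equiv type := EqQuotient.on type.
#[export]
HB.instance Definition _ := Choice.on type.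

Definition zerof : frac := (0, den1).
Definition onef : frac := (1, den1).
Definition oppf (x : frac) : frac := (- x.1, x.2).
Definition addf (x y : frac) : frac :=
  (x.1 * denv y.2 + y.1 * denv x.2, denM x.2 y.2).
Definition mulf (x y : frac) : frac := (x.1 * y.1, denM x.2 y.2).

Definition zero : type := lift_cst type zerof.
Definition one : type := lift_cst type onef.
Definition opp := lift_op1 type oppf.
Definition add := lift_op2 type addf.
Definition mul := lift_op2 type mulf.

Canonical pi_zero_morph := PiConst zero.
Canonical pi_one_morph := PiConst one.

Lemma equiv_repr (x : frac) : equiv (repr (\pi_type x)) x.
Proof. by apply/eqmodP; rewrite reprK. Qed.

Lemma pi_opp : {morph \pi : x / oppf x >-> opp x}.
Proof.
move=> x; unlock opp; apply/eqmodP/equivP.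
have /equivP[u e] := equiv_repr x; exists u => /=.
by rewrite !(mulNr, mulrN) e.
Qed.
Canonical pi_opp_morph := PiMorph1 pi_opp.

Lemma pi_add : {morph \pi : x y / addf x y >-> add x y}.
Proof.
move=> x y; unlock add; apply/eqmodP/equivP.
have /equivP[u e] := equiv_repr x; have /equivP[v f] := equiv_repr y.
set x' := repr _ in e *; set y' := repr _ in f *.
exists (denM u v); rewrite /= !denvM.
transitivity (denv v * denv y.2 * denv y'.2 * (denv u * (x.1 * denv x'.2))
  + denv u * denv x.2 * denv x'.2 * (denv v * (y.1 * denv y'.2))); first by ring.
by rewrite -e -f; ring.
Qed.
Canonical pi_add_morph := PiMorph2 pi_add.

Lemma pi_mul : {morph \pi : x y / mulf x y >-> mul x y}.
Proof.
move=> x y; unlock mul; apply/eqmodP/equivP.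
have /equivP[u e] := equiv_repr x; have /equivP[v f] := equiv_repr y.
set x' := repr _ in e *; set y' := repr _ in f *.
exists (denM u v); rewrite /= !denvM.
transitivity ((denv u * (x.1 * denv x'.2)) * (denv v * (y.1 * denv y'.2)));
  first by ring.
by rewrite -e -f; ring.
Qed.
Canonical pi_mul_morph := PiMorph2 pi_mul.

Lemma pi_eq (x y : frac) :
  x.1 * denv y.2 = y.1 * denv x.2 -> \pi_type x = \pi_type y.
Proof. by move=> e; apply/eqmodP/equivP; exists den1; rewrite e. Qed.

Lemma addA : associative add.
Proof.
move=> x y z; rewrite -[x]reprK -[y]reprK -[z]reprK !piE.
by apply: pi_eq => /=; rewrite ?denvM ?denv1; ring.
Qed.

Lemma addC : commutative add.
Proof.
by move=> x y; rewrite -[x]reprK -[y]reprK !piE; apply: pi_eq => /=; rewrite ?denvM ?denv1; ring.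
Qed.

Lemma add0 : left_id zero add.
Proof. by move=> x; rewrite -[x]reprK !piE; apply: pi_eq => /=; rewrite ?denvM ?denv1; ring. Qed.

Lemma addN : left_inverse zero opp add.
Proof. by move=> x; rewrite -[x]reprK !piE; apply: pi_eq => /=; rewrite ?denvM ?denv1; ring. Qed.

Lemma mulA : associative mul.
Proof.
move=> x y z; rewrite -[x]reprK -[y]reprK -[z]reprK !piE.
by apply: pi_eq => /=; rewrite ?denvM ?denv1; ring.
Qed.

Lemma mulC : commutative mul.
Proof.
by move=> x y; rewrite -[x]reprK -[y]reprK !piE; apply: pi_eq => /=; rewrite ?denvM ?denv1; ring.
Qed.

Lemma mul1 : left_id one mul.
Proof. by move=> x; rewrite -[x]reprK !piE; apply: pi_eq => /=; rewrite ?denvM ?denv1; ring. Qed.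

Lemma mulDl : left_distributive mul add.
Proof.
move=> x y z; rewrite -[x]reprK -[y]reprK -[z]reprK !piE.
by apply: pi_eq => /=; rewrite ?denvM ?denv1; ring.
Qed.

Lemma one_neq0 : one != zero.
Proof.
rewrite piE; apply/equivP => -[u] /= /eqP.
rewrite mul0r mulr0 !mulr1 => /eqP u0.
by have := valP u; rewrite -[val u]/(denv u) u0 idealr0.
Qed.

#[export]
HB.instance Definition _ := GRing.isZmodule.Build type addA addC add0 addN.
#[export]
HB.instance Definition _ :=
  GRing.Zmodule_isComNzRing.Build type mulA mulC mul1 mulDl one_neq0.

End Loc.

Module Exports. HB.reexport. End Exports.
End Loc.
Export Loc.Exports.

Definition localization (R : comNzRingType) (P : prime_idealr R) :
  comNzRingType := Loc.type P.

(* P 0 < P 1 < ... < P d; the values of [P] beyond [d] play no role. *)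
Definition has_prime_chain (R : comNzRingType) (d : nat) : Prop :=
  exists P : nat -> prime_idealr R,
    forall i, (i < d)%N ->
      {subset P i <= P i.+1} /\ ~ {subset P i.+1 <= P i}.

Definition krull_dim (R : comNzRingType) (d : nat) : Prop :=
  has_prime_chain R d /\ (forall e, has_prime_chain R e -> (e <= d)%N).

Definition regular_sequence (R : comNzRingType) (s : seq R) : Prop :=
  (forall (i : nat) (a : R), (i < size s)%N ->
     s`_i * a \in ideal_gen (take i s) -> a \in ideal_gen (take i s))
  /\ 1 \notin ideal_gen s.

Definition has_regular_sequence (R : comNzRingType) (M : idealr R) (d : nat) :
    Prop :=
  exists s : seq R, [/\ size s = d, {subset s <= M} & regular_sequence s].

(* Length of a longest R-regular sequence in M; for a noetherian local ring
   (R, M) this is depth R. *)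
Definition depth (R : comNzRingType) (M : idealr R) (d : nat) : Prop :=
  has_regular_sequence M d /\
  (forall e, has_regular_sequence M e -> (e <= d)%N).

Definition local_ring (R : comNzRingType) (M : idealr R) : Prop :=
  maximal_ideal M /\ (forall N : idealr R, maximal_ideal N -> N =i M).

Definition cohen_macaulay_local (R : comNzRingType) : Prop :=
  exists2 M : idealr R, local_ring M &
    exists d : nat, depth M d /\ krull_dim R d.

(* Maximal ideals are prime, so [P] ranges over all maximal ideals of [R];
   [prime_idealr] is what [localization] takes. *)
Definition cohen_macaulay_ring (R : comNzRingType) : Prop :=
  noetherian R /\
  (forall P : prime_idealr R,
     maximal_ideal P -> cohen_macaulay_local (localization P)).

Definition cohen_macaulay_ideal (S : comNzRingType) (I : idealr S) : Prop :=
  cohen_macaulay_ring {ideal_quot I}.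

Record simple_graph := SimpleGraph {
  vertex :> finType;
  adj : rel vertex;
  adj_sym : ssrbool.symmetric adj;
  adj_irr : irreflexive adj
}.

Definition closed_nbhd (H : simple_graph) (u : H) : {set H} :=
  [set v | (v == u) || adj u v].

Section Square.
Variable H : simple_graph.

Definition square_adj : rel H :=
  fun u v => (u != v) && (adj u v || [exists w, adj u w && adj w v]).

Lemma square_adj_sym : ssrbool.symmetric square_adj.
Proof.
move=> u v; rewrite /square_adj eq_sym adj_sym; congr (_ && (_ || _)).
by apply: eq_existsb => w; rewrite andbC (adj_sym u) (adj_sym w).
Qed.

Lemma square_adj_irr : irreflexive square_adj.
Proof. by move=> u; rewrite /square_adj eqxx. Qed.

Definition graph_square := SimpleGraph square_adj_sym square_adj_irr.

End Square.

Section Broom.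
Variables n m : nat.

(* [inl i] is x_{i+1} and [inr j] is y_{j+1}. *)
Definition broom_vertex : finType := ('I_n + 'I_m)%type.

Definition broom_adj : rel broom_vertex := fun u v =>
  match u, v with
  | inl _, inl _ => false
  | inl _, inr j | inr j, inl _ => j == 0%N :> nat
  | inr j, inr k => (k == j.+1 :> nat) || (j == k.+1 :> nat)
  end.

Lemma broom_adj_sym : ssrbool.symmetric broom_adj.
Proof. by move=> [i|j] [i'|k] //=; rewrite orbC. Qed.

Lemma broom_adj_irr : irreflexive broom_adj.
Proof. by move=> [i|j] //=; rewrite ltn_eqF. Qed.

Definition broom := SimpleGraph broom_adj_sym broom_adj_irr.

Lemma broom_squareE (u v : broom) : (0 < m)%N ->
  @adj (graph_square broom) u v =
  match u, v with
  | inl i, inl k => i != k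
  | inl _, inr j | inr j, inl _ =>
      (j == 0%N :> nat) || (j == 1%N :> nat)
  | inr j, inr k => [|| k == j.+1 :> nat, j == k.+1 :> nat,
                        k == j.+2 :> nat | j == k.+2 :> nat]
  end.
Proof.
move=> m0; pose y1 : broom := inr (Ordinal m0).
case: u v => [i|j] [i'|k]; rewrite /= /square_adj /=.
- have -> : [exists w : broom, broom_adj (inl i) w && broom_adj w (inl i')].
    by apply/existsP; exists y1.
  by rewrite andbT.
- apply/orP/orP => -[]; try by left.
    by case/existsP => -[w|w] //= /andP[/eqP ->] /orP[]; [right|].
  move=> k1; right; apply/existsP; exists y1 => /=; by rewrite k1.
- apply/orP/orP => -[]; try by left.
    case/existsP => -[w|w] /andP[] //= + /eqP w0; rewrite w0 => /orP[//|j1].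
    by right.
  move=> j1; right; apply/existsP; exists y1 => /=; by rewrite j1.
have -> : (inr j != inr k :> broom) = (j != k :> nat) by [].
apply/idP/idP.
  case/andP=> jk /orP[/orP[->|->]|]; rewrite ?orbT //.
  case/existsP => -[w|w] /= /andP[].
    by move=> /eqP j0 /eqP k0; rewrite j0 k0 in jk.
  by move: jk; lia.
move=> h; apply/andP; split; first by lia.
case/or4P: h => [->|->|/eqP e|/eqP e]; rewrite ?orbT //; apply/orP; right.
  have lt : (j.+1 < m)%N by have := ltn_ord k; lia.
  by apply/existsP; exists (inr (Ordinal lt)); rewrite /= e !eqxx.
have lt : (k.+1 < m)%N by have := ltn_ord j; lia.
by apply/existsP; exists (inr (Ordinal lt)); rewrite /= e !eqxx !orbT.
Qed.

End Broom.

Section ClosedNeighborhoodIdeal.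
Variables (K : fieldType) (H : simple_graph).

(* K[V(H)], the vertex v being the variable of index [enum_rank v]. *)
Definition graph_ring : comNzRingType := {mpoly K[#|H|]}.

Definition vertex_var (v : H) : graph_ring := 'X_(enum_rank v).

Definition NI_generators : seq graph_ring :=
  [seq \prod_(v in closed_nbhd u) vertex_var v | u : H].

Definition NI : pred graph_ring := ideal_gen NI_generators.

Lemma NI_idealr_closed : idealr_closed NI.
Proof.
split; first exact: ideal_gen0; last first.
  by move=> a u v; apply: ideal_gen_lin.
apply/asboolP => -[c e].
have := congr1 (meval (fun=> 0)) e; apply/eqP.
rewrite rmorph1 rmorph_sum big1 ?oner_eq0 //= => i _; rewrite rmorphM /=.
have /mapP[u _ ->] : NI_generators`_i \in NI_generators by exact: mem_nth.
rewrite rmorph_prod (bigD1 u) ?inE ?eqxx //= mevalXU mul0r mulr0 //.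
Qed.

HB.instance Definition _ :=
  isIdealr.Build graph_ring NI NI_idealr_closed.

End ClosedNeighborhoodIdeal.

Arguments NI K H : clear implicits.

(* Main.v *)
Require Import Defs.
From HB Require Import structures.
From mathcomp Require Import all_boot all_order all_algebra.
From mathcomp Require Import generic_quotient ring_quotient.
From mathcomp Require Import boolp mpoly zify ring.

(** Both directions are instances of facts on an arbitrary finite graph [H] with
    closed neighborhood ideal [NI] in [S = K[V(H)]].

    If [NI] is Cohen-Macaulay, then no independent dominating set [D] is larger
    than a dominating set [C] ([cohen_macaulay_unmixed]).  Localize at the origin.
    The variables outside [C] are a regular sequence modulo those in [C], and a
    regular sequence gives a chain of primes of the same length, so the dimension
    is at least [|V| - |C|].  The product of the variables outside [D] is nonzero
    and killed by the variables in [D], so the depth is at most [|V| - |D|].  In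
    the square of the broom, taking every fifth vertex of the path gives a
    dominating set with [m / 5 + 1] elements, and a leaf with every third vertex
    of the path an independent dominating set with [m / 3 + 1].  As [m / 3 <= m / 5]
    only for [m = 2] and [m = 5] (when [2 <= m]), no other [m] is possible.

    Conversely, if some closed neighborhoods partition [V(H)] and every closed
    neighborhood contains one of them, then [NI] is generated by monomials in
    disjoint sets of variables and is a complete intersection
    ([perfect_code_cohen_macaulay]).  For [m = 2] a leaf forms such a code, for
    [m = 5] a leaf and the last vertex of the path do.  Let [M] be a maximal ideal
    containing [NI].  The residue field is algebraic over [K] (Zariski's lemma,
    [zariski_lemma]), so [M] contains a monic polynomial in each difference
    [X_i - X_r] of a variable and a chosen variable [X_r] of its block.  In these
    coordinates each monomial is monic in its own [X_r]; monic elements in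
    separate variables form a regular sequence in any order, which shows that
    depth and dimension are at least the number of the differences.

    All upper bounds, on the length of a prime chain as well as on that of a
    regular sequence, come from one argument.  In both cases the elements climb
    through a tower of ideals ([rising_tower]), and such elements are
    algebraically independent over [K] modulo the annihilator of any nonzero class
    modulo the first ideal ([rising_tower_independent]).  If that annihilator
    contains all variables in [C], then counting monomials of bounded degree
    ([algebraic_dependence]) leaves room for at most [|V| - |C|] of them
    ([rising_tower_bound]). *)

Set Implicit Arguments.
Unset Strict Implicit.
Unset Printing Implicit Defensive.

Import Order.TTheory GRing.Theory.
Local Open Scope ring_scope.
Local Open Scope quotient_scope.

(** * Ideals and nonzerodivisors *)

(** Unlike the inhabitants of [idealr], such an ideal may be improper. *)
Definition ideal_prop (R : comNzRingType) (J : R -> Prop) : Prop :=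
  [/\ J 0, forall u v, J u -> J v -> J (u + v) & forall a u, J u -> J (a * u)].

Definition prime_prop (R : comNzRingType) (J : R -> Prop) : Prop :=
  [/\ ideal_prop J, ~ J 1 & forall u v, J (u * v) -> J u \/ J v].

Definition nzd_mod (R : comNzRingType) (J : R -> Prop) (x : R) : Prop :=
  forall a, J (x * a) -> J a.

Definition gen (R : comNzRingType) (s : seq R) : R -> Prop :=
  fun x => x \in ideal_gen s.

Section Ideals.
Variable R : comNzRingType.
Implicit Types (J : R -> Prop) (s : seq R).

Lemma ideal_prop0 J : ideal_prop J -> J 0. Proof. by case. Qed.

Lemma ideal_propD J u v : ideal_prop J -> J u -> J v -> J (u + v).
Proof. by case=> _ h _; apply: h. Qed.

Lemma ideal_propMl J a u : ideal_prop J -> J u -> J (a * u).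
Proof. by case=> _ _; apply. Qed.

Lemma ideal_propMr J a u : ideal_prop J -> J u -> J (u * a).
Proof. by rewrite mulrC; apply: ideal_propMl. Qed.

Lemma ideal_propN J u : ideal_prop J -> J u -> J (- u).
Proof. by rewrite -mulN1r; apply: ideal_propMl. Qed.

Lemma ideal_propB J u v : ideal_prop J -> J u -> J v -> J (u - v).
Proof. by move=> iJ Ju Jv; apply: ideal_propD => //; apply: ideal_propN. Qed.

Lemma ideal_propBr J u v : ideal_prop J -> J v -> J (u - v) -> J u.
Proof. by move=> iJ Jv Juv; rewrite -[u](subrK v); apply: ideal_propD. Qed.

Lemma ideal_prop_sum J (I : Type) (r : seq I) (P : pred I) (F : I -> R) :
  ideal_prop J -> (forall i, P i -> J (F i)) -> J (\sum_(i <- r | P i) F i).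
Proof.
move=> iJ h; apply: big_ind => //; first exact: ideal_prop0.
by move=> u v; apply: ideal_propD.
Qed.

Lemma nzd_modM J x y : nzd_mod J x -> nzd_mod J y -> nzd_mod J (x * y).
Proof. by move=> hx hy a; rewrite -mulrA => /hx/hy. Qed.

Lemma gen_ideal s : ideal_prop (gen s).
Proof.
split; first exact: ideal_gen0.
  by move=> u v su sv; rewrite /gen -[u]mul1r; apply: ideal_gen_lin.
by move=> a u su; rewrite /gen -[_ * _]addr0; apply: ideal_gen_lin (ideal_gen0 s).
Qed.

Lemma gen0 s : gen s 0. Proof. exact: ideal_gen0. Qed.

Lemma genD s x y : gen s x -> gen s y -> gen s (x + y).
Proof. exact: ideal_propD (gen_ideal s). Qed.

Lemma genMl s a x : gen s x -> gen s (a * x).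
Proof. exact: ideal_propMl (gen_ideal s). Qed.

Lemma gen_mem s x : x \in s -> gen s x.
Proof.
move=> /(nthP 0)[i ilt <-]; apply/asboolP; exists (fun j => (j == i)%:R).
rewrite (bigD1 (Ordinal ilt)) //= eqxx mul1r big1 ?addr0 // => j /eqP nj.
by case: eqP => [e|_]; rewrite ?mul0r //; case: nj; apply: val_inj.
Qed.

Lemma gen_min s J : ideal_prop J -> (forall x, x \in s -> J x) ->
  forall y, gen s y -> J y.
Proof.
move=> iJ h y /asboolP[c ->]; apply: ideal_prop_sum => // i _.
by apply: ideal_propMl => //; apply/h/mem_nth.
Qed.

Lemma gen_sub s t : {subset s <= t} -> forall y, gen s y -> gen t y.
Proof.
by move=> st; apply: gen_min; [exact: gen_ideal | move=> x /st /gen_mem].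
Qed.

Lemma gen_eq s t : s =i t -> forall y, gen s y -> gen t y.
Proof. by move=> st; apply: gen_sub => x; rewrite st. Qed.

Definition adjoin J x : R -> Prop := fun y => exists a, J (y - a * x).

Lemma adjoin_ideal J x : ideal_prop J -> ideal_prop (adjoin J x).
Proof.
move=> iJ; split.
- by exists 0; rewrite mul0r subr0; apply: ideal_prop0.
- move=> u v [a ha] [b hb]; exists (a + b).
  have -> : u + v - (a + b) * x = (u - a * x) + (v - b * x) by ring.
  exact: ideal_propD.
move=> c u [a ha]; exists (c * a).
have -> : c * u - c * a * x = c * (u - a * x) by ring.
exact: ideal_propMl.
Qed.

Lemma sub_adjoin J x y : J y -> adjoin J x y.
Proof. by move=> Jy; exists 0; rewrite mul0r subr0. Qed.

Lemma adjoin_self J x : ideal_prop J -> adjoin J x x.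
Proof. by move=> iJ; exists 1; rewrite mul1r subrr; apply: ideal_prop0. Qed.

Lemma adjoin_min J x J' : ideal_prop J' -> (forall y, J y -> J' y) -> J' x ->
  forall y, adjoin J x y -> J' y.
Proof.
move=> iJ' JJ' J'x y [a /JJ' h]; apply: ideal_propBr h => //.
exact: ideal_propMl.
Qed.

Lemma gen_cons_adjoin s x y : gen (x :: s) y <-> adjoin (gen s) x y.
Proof.
split; last first.
  apply: adjoin_min; [exact: gen_ideal | | exact/gen_mem/mem_head].
  by apply: gen_sub => z zs; rewrite in_cons zs orbT.
apply: gen_min => [|z]; first exact/adjoin_ideal/gen_ideal.
rewrite in_cons => /predU1P[->|zs]; first exact/adjoin_self/gen_ideal.
exact/sub_adjoin/gen_mem.
Qed.

(** The regular element [w] survives the passage from [J] to [J + (f)], for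
    a syzygy [w h = c f] modulo [J] forces [c] to be a multiple of [w]; this is
    how a regular sequence is reordered. *)
Lemma nzd_mod_swap J w f : ideal_prop J ->
  nzd_mod J w -> nzd_mod (adjoin J w) f -> nzd_mod (adjoin J f) w.
Proof.
move=> iJ nw nf h [c hc]; have iJw := adjoin_ideal w iJ.
have /nf [d hd] : adjoin J w (f * c).
  exists h; have -> : f * c - h * w = - (w * h - c * f) by ring.
  exact: ideal_propN.
exists d; apply: nw.
have -> : w * (h - d * f) = (w * h - c * f) + f * (c - d * w) by ring.
by apply: ideal_propD => //; apply: ideal_propMl.
Qed.

Lemma nzd_mod_ext J J' x : (forall y, J y <-> J' y) -> nzd_mod J x -> nzd_mod J' x.
Proof. by move=> e h a /e /h /e. Qed.

End Ideals.

Definition ideal_of (R : comNzRingType) (J : R -> Prop) : {pred R} :=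
  fun x => `[< J x >].

Lemma ideal_of_closed (R : comNzRingType) (J : R -> Prop) :
  ideal_prop J -> ~ J 1 -> idealr_closed (ideal_of J).
Proof.
move=> iJ J1; split; [by apply/asboolP; exact: ideal_prop0 | by apply/asboolP |].
move=> a u v /asboolP Ju /asboolP Jv; apply/asboolP.
by apply: ideal_propD => //; apply: ideal_propMl.
Qed.

Definition mk_ideal (R : comNzRingType) (J : R -> Prop) (iJ : ideal_prop J)
    (J1 : ~ J 1) : idealr R :=
  HB.pack_for (idealr R) (ideal_of J : R -> bool)
    (isIdealr.Build R (ideal_of J) (ideal_of_closed iJ J1)).

Lemma prime_of_closed (R : comNzRingType) (J : R -> Prop) :
  prime_prop J -> prime_idealr_closed (ideal_of J).
Proof.
case=> _ _ h u v /asboolP /h[]; [move=> Ju|move=> Jv]; apply/orP; [left|right];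
  exact/asboolP.
Qed.

Definition mk_prime (R : comNzRingType) (J : R -> Prop) (pJ : prime_prop J) :
    prime_idealr R :=
  HB.pack_for (prime_idealr R) (ideal_of J : R -> bool)
    (isIdealr.Build R (ideal_of J)
       (ideal_of_closed (let: And3 i _ _ := pJ in i) (let: And3 _ n _ := pJ in n)))
    (isPrimeIdealrClosed.Build R (ideal_of J) (prime_of_closed pJ)).

Lemma mk_idealE (R : comNzRingType) (J : R -> Prop) (iJ : ideal_prop J)
  (J1 : ~ J 1) x : (x \in (mk_ideal iJ J1 : pred R)) <-> J x.
Proof. by split=> /asboolP. Qed.

Lemma mk_primeE (R : comNzRingType) (J : R -> Prop) (pJ : prime_prop J) x :
  (x \in (mk_prime pJ : pred R)) <-> J x.
Proof. by split=> /asboolP. Qed.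

Lemma idealr_prop (R : comNzRingType) (I : idealr R) :
  ideal_prop (fun x => x \in (I : pred R)).
Proof.
split=> [|u v|a u]; [exact: idealr0 | exact: rpredD | exact: idealMr].
Qed.

Lemma prime_idealr_prop (R : comNzRingType) (P : prime_idealr R) :
  prime_prop (fun x => x \in (P : pred R)).
Proof.
split; first exact: idealr_prop.
  by rewrite idealr1.
by move=> u v; rewrite prime_idealrM => /orP.
Qed.

(** * Noetherian rings *)

Section Noetherian.
Variable R : comNzRingType.
Hypothesis noeR : noetherian R.

Lemma noetherian_fg (J : R -> Prop) : ideal_prop J ->
  exists s : seq R, forall x, J x <-> gen s x.
Proof.
move=> iJ; case: (pselect (J 1)) => [J1|J1].
  exists [:: 1] => x; split=> _.
    by rewrite -[x]mulr1; apply: ideal_propMl; [exact: gen_ideal | exact/gen_mem/mem_head].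
  by rewrite -[x]mulr1; apply: ideal_propMl.
have [s e] := noeR (mk_ideal iJ J1); exists s => x.
by rewrite /gen -(e x); split => [/mk_idealE|/mk_idealE]; apply.
Qed.

(** Otherwise an ascending chain could be continued forever, while its union is
    generated by finitely many elements, which all lie in one of its members. *)
Lemma noetherian_max (A : Type) (P : A -> Prop) (J : A -> R -> Prop) :
  (forall a, P a -> ideal_prop (J a)) -> (exists a, P a) ->
  exists2 a, P a & forall b, P b -> (forall x, J a x -> J b x) ->
    forall x, J b x -> J a x.
Proof.
move=> iJ [a0 Pa0]; apply: contrapT => nomax.
have step (a : {a | P a}) : exists b : {a | P a},
    (forall x, J (sval a) x -> J (sval b) x) /\
    exists x, J (sval b) x /\ ~ J (sval a) x.
  case: a => a Pa /=; apply: contrapT => h; apply: nomax; exists a => // b Pb ab x Jbx.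
  apply: contrapT => nJ; apply: h; exists (exist _ b Pb); split=> //.
  by exists x.
have [g hg] := choice step.
pose c k := iter k g (exist _ a0 Pa0).
have c1 k x : J (sval (c k)) x -> J (sval (c k.+1)) x by move=> h; apply: (hg (c k)).1.
have cle k l x : (k <= l)%N -> J (sval (c k)) x -> J (sval (c l)) x.
  by move=> /subnKC <-; elim: (l - k)%N => [|d IH]; rewrite ?addn0 // addnS => /IH /c1.
pose U x := exists k, J (sval (c k)) x.
have ic k : ideal_prop (J (sval (c k))) by apply: iJ; exact: svalP.
have iU : ideal_prop U.
  split; first by exists 0%N; apply: ideal_prop0.
    move=> u v [k hu] [l hv]; exists (maxn k l).
    by apply: ideal_propD => //; [apply: cle hu | apply: cle hv]; rewrite leq_max leqnn ?orbT.
  by move=> a u [k hu]; exists k; apply: ideal_propMl.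
have [s es] := noetherian_fg iU.
have [k hk] : exists k, forall x, x \in s -> J (sval (c k)) x.
  have : forall x, x \in s -> U x by move=> x /gen_mem /es.
  elim: (s) => [|y t IH] h; first by exists 0%N.
  have [k hk] := IH (fun x xt => h x (mem_behead (s := y :: t) xt)).
  have [l hl] := h y (mem_head _ _).
  exists (maxn k l) => x; rewrite in_cons => /predU1P[->|xt].
    by apply: cle hl; rewrite leq_maxr.
  by apply: cle (hk x xt); rewrite leq_maxl.
have [_ [x [hx nx]]] := hg (c k); apply: nx.
by apply: (gen_min (ic k) hk); apply/es; exists k.+1.
Qed.

(** An ideal that is maximal among those containing [J] and avoiding the
    multiplicative set of the [t * x ^+ k], [t] outside [Q], is prime; since [x]
    is a nonzerodivisor modulo [J] and [J] lies in [Q], [J] is such an ideal. *)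
Lemma prime_below (J Q : R -> Prop) (x : R) :
  ideal_prop J -> prime_prop Q -> (forall y, J y -> Q y) -> nzd_mod J x ->
  exists Q', [/\ prime_prop Q', forall y, J y -> Q' y,
                 forall y, Q' y -> Q y & ~ Q' x].
Proof.
move=> iJ [iQ Q1 pQ] JQ nx.
pose W y := exists t k, ~ Q t /\ y = t * x ^+ k.
have W1 : W 1 by exists 1, 0%N; rewrite mulr1.
have WM y z : W y -> W z -> W (y * z).
  move=> [t [k [Qt ->]]] [u [l [Qu ->]]]; exists (t * u), (k + l)%N; split.
    by case/pQ.
  by rewrite exprD; ring.
pose P (I : R -> Prop) :=
  [/\ ideal_prop I, forall y, J y -> I y & forall y, I y -> ~ W y].
have [|I [iI JI IW] maxI] := @noetherian_max (R -> Prop) P id (fun I '(And3 h _ _) => h).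
  exists J; split=> // y + [t [k [Qt e]]]; rewrite {}e => Jy; apply/Qt/JQ.
  elim: k t {Qt} Jy => [|k IH] t; first by rewrite mulr1.
  by rewrite exprS mulrCA => /nx /IH.
exists I; split=> // [|y Iy|Ix]; last 2 first.
- apply: contrapT => Qy; apply: (IW _ Iy).
  by exists y, 0%N; rewrite mulr1.
- by apply: (IW _ Ix); exists 1, 1%N; rewrite mul1r expr1.
split=> // [I1|u v Iuv]; first exact: IW I1 W1.
have meet z : ~ I z -> exists a y, I (y - a * z) /\ W y.
  move=> nIz; apply: contrapT => h; apply: nIz.
  apply: (maxI (adjoin I z)) (adjoin_self _ iI); last exact: sub_adjoin.
  split; first exact: adjoin_ideal.
    by move=> y /JI; apply: sub_adjoin.
  by move=> y [a ha] Wy; apply: h; exists a, y.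
apply: contrapT => /not_orP[/meet[a [y [hy Wy]]] /meet[b [z [hz Wz]]]].
apply: IW (WM _ _ Wy Wz).
have -> : y * z = (y - a * u) * z + a * u * (z - b * v) + a * b * (u * v) by ring.
apply: ideal_propD => //; last exact: ideal_propMl.
by apply: ideal_propD => //; [exact: ideal_propMr | exact: ideal_propMl].
Qed.

(** Start at [P] and descend, keeping the [i]-th prime above [J i]. *)
Lemma prime_chain_of_nzd (d : nat) (J : nat -> R -> Prop) (x : nat -> R)
    (P : prime_idealr R) :
  (forall i, (i <= d)%N -> ideal_prop (J i)) ->
  (forall i, (i < d)%N ->
     [/\ forall y, J i y -> J i.+1 y, J i.+1 (x i) & nzd_mod (J i) (x i)]) ->
  (forall y, J d y -> y \in (P : pred R)) ->
  has_prime_chain R d.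
Proof.
move=> iJ step JP.
suff [Q _ h] : exists2 Q : nat -> prime_idealr R, Q d = P & forall i, (i < d)%N ->
    {subset Q i <= Q i.+1} /\ ~ {subset Q i.+1 <= Q i} by exists Q.
elim: d P iJ step JP => [|d IH] P iJ step JP; first by exists (fun=> P).
have [J1 Jx nx] := step d (ltnSn d).
have [|Q [pQ JQ QP Qx]] := prime_below (iJ d (leqnSn d)) (prime_idealr_prop P) _ nx.
  by move=> y /J1 /JP.
have [|||f fd hf] := IH (mk_prime pQ).
- by move=> i /leqW; apply: iJ.
- by move=> i /leqW; apply: step.
- by move=> y /JQ /mk_primeE.
exists (fun i => if (i <= d)%N then f i else P) => [|i]; first by rewrite ltnn.
rewrite ltnS => ile.
have /predU1P[->|id] : (i == d) || (i < d)%N by rewrite -leq_eqVlt.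
  rewrite leqnn ltnn fd; split=> [y /mk_primeE /QP //|/(_ (x d))/(_ (JP _ Jx))].
  by move/mk_primeE.
by rewrite ile id; apply: hf.
Qed.

End Noetherian.

(** * Localizations of quotients *)

(** [phi : S -> T] presents [T] as the localization of [S / I] at the complement
    of [M]; working with numerators in [S] avoids both layers of quotients. *)
Definition is_localization (S T : comNzRingType) (phi : {rmorphism S -> T})
    (I M : S -> Prop) : Prop :=
  [/\ forall y, exists s a, ~ M s /\ phi s * y = phi a,
      forall a, phi a = 0 <-> exists s, ~ M s /\ I (s * a)
    & forall s, ~ M s -> exists t, t * phi s = 1].

Section LocalizationMap.
Import Loc.
Variables (R : comNzRingType) (P : prime_idealr R).

Definition loc_map (a : R) : localization P := \pi_(Loc.type P) (a, Loc.den1 P).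

Lemma loc_map_zmod : zmod_morphism loc_map.
Proof.
move=> x y; rewrite -[RHS]/(Loc.add (loc_map x) (Loc.opp (loc_map y))) /loc_map !piE.
by apply: Loc.pi_eq => /=; rewrite ?Loc.denvM ?Loc.denv1; ring.
Qed.

Lemma loc_map_monoid : monoid_morphism loc_map.
Proof.
split; first by rewrite -[RHS]/(Loc.one P) /loc_map !piE.
move=> x y; rewrite -[RHS]/(Loc.mul (loc_map x) (loc_map y)) /loc_map !piE.
by apply: Loc.pi_eq => /=; rewrite ?Loc.denvM ?Loc.denv1; ring.
Qed.

HB.instance Definition _ := GRing.isZmodMorphism.Build _ _ loc_map loc_map_zmod.
HB.instance Definition _ := GRing.isMonoidMorphism.Build _ _ loc_map loc_map_monoid.

Lemma loc_map_localization :
  is_localization loc_map (fun a => a = 0) (fun a => a \in (P : pred R)).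
Proof.
split.
- move=> y; case e: (repr (y : Loc.type P)) => [a s].
  exists (Loc.denv s), a; split; first exact/negP/(valP s).
  rewrite -[LHS]/(Loc.mul (loc_map (Loc.denv s)) y) -[y in LHS](@reprK _ (Loc.type P)) e.
  rewrite /loc_map !piE; apply: Loc.pi_eq => /=.
  by rewrite ?Loc.denvM ?Loc.denv1; ring.
- move=> a; rewrite -[0 in X in X <-> _]/(Loc.zero P) /loc_map !piE; split.
    move=> /eqmodP /Loc.equivP[u] /=.
    rewrite !Loc.denv1 !mulr1 mulr0 => e; exists (val u); split=> //.
    exact/negP/(valP u).
  move=> [s [/negP Ps sa]].
  apply/eqmodP/Loc.equivP; exists (Sub s Ps : Loc.den P) => /=.
  by rewrite !Loc.denv1 !mulr1 mulr0 /Loc.denv /= sa.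
move=> s /negP Ps; pose d : Loc.den P := Sub s Ps.
exists (\pi_(Loc.type P) (1, d)).
rewrite -[RHS]/(Loc.one P) -[LHS]/(Loc.mul (\pi_(Loc.type P) (1, d)) (loc_map s)) /loc_map.
rewrite !piE; apply: Loc.pi_eq => /=.
by rewrite ?Loc.denvM ?Loc.denv1 /Loc.denv /=; ring.
Qed.

End LocalizationMap.

Lemma localization_comp (S R T : comNzRingType) (pi : {rmorphism S -> R})
    (phi : {rmorphism R -> T}) (I : S -> Prop) (M : R -> Prop) :
  (forall y, exists x, pi x = y) -> (forall x, pi x = 0 <-> I x) ->
  is_localization phi (fun a => a = 0) M ->
  is_localization (phi \o pi) I (M \o pi).
Proof.
move=> sur ker [num zer uni]; split=> /=.
- move=> y; have [s [a [Ms e]]] := num y.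
  have [s' es] := sur s; have [a' ea] := sur a.
  by exists s', a'; rewrite es ea.
- move=> a; rewrite zer; split=> -[s [Ms sa]].
    by have [s' es] := sur s; exists s'; rewrite es; split=> //; apply/ker; rewrite rmorphM es.
  by exists (pi s); split=> //; rewrite -rmorphM; apply/ker.
by move=> s /uni.
Qed.

Section Localization.
Variables (S T : comNzRingType) (phi : {rmorphism S -> T}) (I M : S -> Prop).
Hypothesis pM : prime_prop M.
Hypothesis (locT : is_localization phi I M).

Let iM : ideal_prop M. Proof. by case: pM. Qed.

Let denM s t : ~ M s -> ~ M t -> ~ M (s * t).
Proof. by case: pM => _ _ h Ms Mt /h[]. Qed.

Lemma loc_num y : exists s a, ~ M s /\ phi s * y = phi a.
Proof. by case: locT. Qed.

Lemma loc_unit s : ~ M s -> exists t, t * phi s = 1.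
Proof. by case: locT => _ _; apply. Qed.

Lemma loc_sub0 a : I a -> phi a = 0.
Proof.
case: locT => _ h _ Ia; apply/h; exists 1; rewrite mul1r; split=> //.
by case: pM.
Qed.

Lemma loc_unitP a : (exists t, t * phi a = 1) -> ~ M a.
Proof.
move=> [t e] Ma; case: locT => num zer _.
have [s [b [Ms eb]]] := num t.
have : phi (s - b * a) = 0 by rewrite rmorphB rmorphM -eb -mulrA e mulr1 subrr.
move=> /zer[u [Mu Iu]].
(* an element of [I] lies in [M], as [1] would otherwise vanish in [T] *)
have Mu' : M (u * (s - b * a)).
  apply: contrapT => nM; have : phi (u * (s - b * a)) = 0 by apply: loc_sub0.
  have [v ev] := loc_unit nM => e0; move: ev; rewrite e0 mulr0 => /eqP.
  by rewrite eq_sym oner_eq0.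
apply: (denM Mu Ms); have -> : u * s = u * (s - b * a) + u * b * a by ring.
by apply: ideal_propD => //; apply: ideal_propMl.
Qed.

(** If [y = a / s] is not a unit then [a] lies in [M], and the numerator of
    [1 - r * y] stays outside [M]. *)
Lemma loc_local (y : T) :
  ~ (exists t, t * y = 1) -> forall r, exists t, t * (1 - r * y) = 1.
Proof.
move=> ny r; have [s [a [Ms ey]]] := loc_num y; have [u [b [Mu er]]] := loc_num r.
have Ma : M a.
  apply: contrapT => /loc_unit[t et]; apply: ny; exists (t * phi s).
  by rewrite -mulrA ey.
have Mn : ~ M (u * s - b * a).
  move=> h; apply: (denM Mu Ms); apply: ideal_propBr h => //.
  exact: ideal_propMl.
have [t et] := loc_unit Mn; exists (t * phi (u * s)).
rewrite -[RHS]et rmorphB !rmorphM -ey -er; ring.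
Qed.

Lemma loc_noetherian : noetherian S -> noetherian T.
Proof.
move=> noeS J; pose J' a := phi a \in (J : pred T).
have iJ' : ideal_prop J'.
  split; rewrite /J'; first by rewrite rmorph0 idealr0.
    by move=> u v; rewrite rmorphD; apply: rpredD.
  by move=> a u; rewrite rmorphM; apply: idealMr.
have [s es] := noetherian_fg noeS iJ'; exists (map phi s) => y.
have iJ := idealr_prop J.
apply/idP/idP => [Jy|]; last first.
  by apply: (gen_min iJ) => _ /mapP[x /gen_mem/es Jx ->].
have [d [a [Md e]]] := loc_num y; have [t et] := loc_unit Md.
have -> : y = t * phi a by rewrite -e mulrA et mul1r.
apply: genMl.
have /es : J' a by rewrite /J' -e; apply: idealMr.
move: (a); apply: (@gen_min _ s (fun x => gen (map phi s) (phi x))) => [|x xs].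
  2: exact/gen_mem/map_f.
split; first by rewrite rmorph0; apply: gen0.
  by move=> u v hu hv; rewrite rmorphD; apply: genD.
by move=> c u hu; rewrite rmorphM; apply: genMl.
Qed.

(** Ideals containing [I] and their extensions are compared through numerators:
    the elements all of whose numerators are, up to a factor outside [M], in the
    ideal generated by [l] form an ideal of [T]. *)
Lemma loc_gen (l : seq S) : (forall x, I x -> gen l x) ->
  forall a, gen (map phi l) (phi a) <-> exists s, ~ M s /\ gen l (s * a).
Proof.
move=> Il a; split; last first.
  move=> [s [/loc_unit[t et] h]].
  have -> : phi a = t * phi (s * a) by rewrite rmorphM mulrA et mul1r.
  apply: genMl; move: h; move: (s * a).
  apply: gen_min => [|x xs /=]; last by apply/gen_mem/map_f.
  split; first by rewrite rmorph0; apply: gen0.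
    by move=> u v hu hv; rewrite rmorphD; apply: genD.
  by move=> c u hu; rewrite rmorphM; apply: genMl.
move=> h; pose J y := forall s a, phi s * y = phi a -> exists u, ~ M u /\ gen l (u * a).
suff : J (phi a) by move=> /(_ 1 a); apply; rewrite rmorph1 mul1r.
have n1 : ~ M 1 by case: pM.
have zer b : phi b = 0 -> exists u, ~ M u /\ gen l (u * b).
  by case: locT => _ z _ /z[u [Mu /Il]]; exists u.
have iL := gen_ideal l.
(* the condition on numerators does not depend on the fraction chosen *)
have mono c b c' : ~ M c -> phi c * phi b = phi c' ->
    (exists u, ~ M u /\ gen l (u * c')) <-> (exists u, ~ M u /\ gen l (u * b)).
  move=> Mc e; have [|v [Mv hv]] := zer (c * b - c').
    by rewrite rmorphB rmorphM e subrr.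
  split=> -[u [Mu hu]].
    exists (u * v * c); split; first by apply: denM => //; apply: denM.
    have -> : u * v * c * b = u * (v * (c * b - c')) + v * (u * c') by ring.
    by apply: ideal_propD => //; apply: ideal_propMl.
  exists (u * v); split; first exact: denM.
  have -> : u * v * c' = c * v * (u * b) - u * (v * (c * b - c')) by ring.
  by apply: ideal_propB => //; apply: ideal_propMl.
suff iJ : ideal_prop J.
  apply: gen_min h => // y /mapP[x xl ->] s b e.
  have [|u [Mu hu]] := zer (s * x - b); first by rewrite rmorphB rmorphM e subrr.
  exists u; split=> //; have -> : u * b = u * s * x - u * (s * x - b) by ring.
  by apply: ideal_propB => //; apply: ideal_propMl => //; apply: gen_mem.
split=> [s b|u v hu hv s b e|c u hu s b e].
- by rewrite mulr0 => /esym /zer.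
- have [d [x [Md ex]]] := loc_num u; have [f [y [Mf ey]]] := loc_num v.
  have [u1 [Mu1 h1]] := hu _ _ ex; have [v1 [Mv1 h2]] := hv _ _ ey.
  apply/(@mono (d * f) b (s * (f * x + d * y))); first exact: denM.
    by rewrite -e !rmorphM rmorphD !rmorphM -ex -ey; ring.
  exists (u1 * v1); split; first exact: denM.
  have -> : u1 * v1 * (s * (f * x + d * y)) =
    v1 * s * f * (u1 * x) + u1 * s * d * (v1 * y) by ring.
  by apply: ideal_propD => //; apply: ideal_propMl.
have [d [x [Md ex]]] := loc_num u; have [f [y [Mf ey]]] := loc_num c.
have [u1 [Mu1 h1]] := hu _ _ ex.
apply/(@mono (d * f) b (s * (y * x))); first exact: denM.
  by rewrite -e !rmorphM -ex -ey; ring.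
exists u1; split=> //; have -> : u1 * (s * (y * x)) = s * y * (u1 * x) by ring.
exact: ideal_propMl.
Qed.

Lemma loc_nzd (l : seq S) (w : S) : (forall x, I x -> gen l x) ->
  nzd_mod (gen l) w -> nzd_mod (gen (map phi l)) (phi w).
Proof.
move=> Il nw y h; have [s [a [Ms e]]] := loc_num y; have [t et] := loc_unit Ms.
have -> : y = t * phi a by rewrite -e mulrA et mul1r.
apply: genMl; apply/loc_gen => //.
have /loc_gen[//|u [Mu]] : gen (map phi l) (phi (w * a)).
  by rewrite rmorphM -e mulrCA; apply/genMl.
by rewrite mulrCA => /nw hu; exists u.
Qed.

End Localization.

(** * Algebraic independence of elements rising through a tower of ideals *)

(** The last clause asks that a relation killing a nonzero element of [T / J i]
    also kills a nonzero element of [T / J i.+1].  A chain of primes satisfies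
    it with [u' = 1]; a regular sequence of a noetherian local ring satisfies it
    because one cannot divide by a nonunit forever. *)
Definition rising_tower (T : comNzRingType) (d : nat) (J : nat -> T -> Prop)
    (x : nat -> T) : Prop :=
  (forall i, (i <= d)%N -> ideal_prop (J i)) /\
  (forall i, (i < d)%N ->
     [/\ forall y, J i y -> J i.+1 y, J i.+1 (x i), nzd_mod (J i) (x i)
       & forall u, ~ J i u -> exists u', ~ J i.+1 u' /\
           forall g, J i (g * u) -> J i (g * u')]).

(** Divide the relation by the largest power of [x 0] that occurs in all its
    terms and reduce it modulo [J 1]: the terms that survive no longer contain
    [x 0].  After [d] such steps a single term is left, a unit times an element
    outside [J d]. *)
Lemma rising_tower_independent (T : comNzRingType) (d : nat)
    (J : nat -> T -> Prop) (x : nat -> T) (I : finType) (A : {set I})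
    (e : I -> nat -> nat) (c : I -> T) (u : T) :
  rising_tower d J x ->
  (forall j, j \in A -> exists t, t * c j = 1) ->
  {in A &, forall j j', (forall k, (k < d)%N -> e j k = e j' k) -> j = j'} ->
  ~ J 0%N u ->
  J 0%N ((\sum_(j in A) c j * \prod_(0 <= k < d) x k ^+ e j k) * u) ->
  A = set0.
Proof.
move=> [iJ step] uc inj Ju rel; apply/eqP; apply: contrapT => /negP /set0Pn[j1 Aj1].
have nX i k a : (i < d)%N -> J i (x i ^+ k * a) -> J i a.
  move=> /step[_ _ nx _]; elim: k a => [|k IH] a; first by rewrite mul1r.
  by rewrite exprS -mulrA => /nx /IH.
suff claim i : (i <= d)%N -> exists (B : {set I}) v, [/\ B \subset A, B != set0, ~ J i v,
    {in B &, forall j j' k, (k < i)%N -> e j k = e j' k}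
  & J i ((\sum_(j in B) c j * \prod_(i <= k < d) x k ^+ e j k) * v)].
  have [B [v [/subsetP BA /set0Pn[j Bj] Jv agree h]]] := claim d (leqnn d).
  have B1 : B = [set j].
    apply/setP => j'; rewrite inE; apply/idP/eqP => [Bj'|->//].
    by apply: inj (BA _ Bj') (BA _ Bj) _; apply: agree.
  have [t ut] := uc j (BA _ Bj); apply: Jv.
  have -> : v = t * (c j * v) by rewrite mulrA ut mul1r.
  apply: ideal_propMl; first exact: iJ.
  by move: h; rewrite B1 big_set1 big_geq ?mulr1.
elim: i => [|i IH] id.
  by exists A, u; split=> //; apply/set0Pn; exists j1.
have [B [v [BA /set0Pn[j0 Bj0] Jv agree h]]] := IH (ltnW id).
have iJi := iJ i (ltnW id); have iJi1 := iJ i.+1 id.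
have [Jsub Jx nx sep] := step i id.
case: (arg_minnP (fun j => e j i) Bj0) => {Bj0} j2 Bj2 min2.
pose k0 := e j2 i; pose G j := c j * (x i ^+ (e j i - k0) *
  \prod_(i.+1 <= k < d) x k ^+ e j k).
have hG : J i ((\sum_(j in B) G j) * v).
  apply: (nX _ k0 _ id); rewrite mulrA mulr_sumr; congr (J i _): h; congr (_ * _).
  apply: eq_bigr => j Bj; rewrite big_ltn // -{1}(subnKC (min2 j Bj)) exprD /G.
  by rewrite /k0; ring.
have [v' [Jv' hv']] := sep v Jv.
exists [set j in B | e j i == k0], v'; split=> //.
- by apply: subset_trans BA; apply/subsetP => j; rewrite inE => /andP[].
- by apply/set0Pn; exists j2; rewrite inE eqxx andbT.
- move=> j j'; rewrite !inE => /andP[Bj /eqP ej] /andP[Bj' /eqP ej'] k.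
  rewrite ltnS leq_eqVlt => /predU1P[->|]; first by rewrite ej ej'.
  exact: agree.
move: hG => /hv' /Jsub; rewrite (bigID (fun j => e j i == k0)) /= mulrDl.
set s1 := \sum_(j in B | _) _; set s2 := \sum_(j in B | _) _ => h12.
have hs2 : J i.+1 (s2 * v').
  apply: ideal_propMr => //; apply: ideal_prop_sum => // j /andP[Bj nj].
  rewrite /G; apply: ideal_propMl => //; apply: ideal_propMr => //.
  have : (0 < e j i - k0)%N by rewrite subn_gt0 ltn_neqAle eq_sym nj min2.
  by case: (_ - _)%N => // m _; rewrite exprS; apply: ideal_propMr.
have : J i.+1 (s1 * v').
  by rewrite -[s1 * v'](addrK (s2 * v')); apply: ideal_propB.
congr (J i.+1 (_ * v')); rewrite /s1; apply: eq_big => [j|j /andP[_ /eqP ej]]; first by rewrite inE.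
by rewrite /G ej subnn mul1r.
Qed.

(** * Algebraic dependence modulo a set of variables *)

Section Dependence.
Variables (K : fieldType) (N : nat).
Local Notation S := {mpoly K[N]}.
Implicit Types (C : {set 'I_N}) (J : S -> Prop).

Lemma mem_coord_ideal C J (p : S) : ideal_prop J -> (forall i, i \in C -> J 'X_i) ->
  (forall m : 'X_{1..N}, (forall i, i \in C -> m i = 0%N) -> p@_m = 0) -> J p.
Proof.
move=> iJ JC h; rewrite [p]mpolyE big_seq; apply: ideal_prop_sum => // m.
rewrite mcoeff_msupp => pm.
have [i Ci mi] : exists2 i, i \in C & m i != 0%N.
  apply: contrapT => nm; move/eqP: pm; apply; apply: h => i Ci.
  by apply/eqP; apply: contrapT => /negP mi; apply: nm; exists i.
rewrite -lep1mP in mi; rewrite -(submK mi) mpolyXD -mul_mpolyC mulrA.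
by apply: ideal_propMl => //; apply: JC.
Qed.

Let degle k (p : S) := forall m, m \in msupp p -> (mdeg m <= k)%N.

Let degleM k l p q : degle k p -> degle l q -> degle (k + l) (p * q).
Proof.
move=> hp hq m /msuppM_le /allpairsP[[m1 m2] [/= /hp h1 /hq h2 ->]].
by rewrite mdegD leq_add.
Qed.

Let degle1 k : degle k 1.
Proof. by move=> m; rewrite msupp1 inE => /eqP ->; rewrite mdeg0. Qed.

Let degleX k n p : degle k p -> degle (n * k) (p ^+ n).
Proof.
move=> hp; elim: n => [|n IH]; first by rewrite expr0; apply: degle1.
by rewrite exprS mulSn; apply: degleM.
Qed.

(** If [D] bounds the degrees of the [a i], then the [T ^ e] monomials in [a] with
    all exponents below [T] have degree at most [e * T * D], so modulo the variables in [C] they live in a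
    space of dimension at most [(e * T * D + 1) ^ (N - #|C|)], which is smaller
    than [T ^ e] for [T] large. *)
Lemma algebraic_dependence C e (a : 'I_e -> S) : (N - #|C| < e)%N ->
  exists T (c : {ffun 'I_e -> 'I_T} -> K), (exists f, c f != 0) /\
    forall J, ideal_prop J -> (forall i, i \in C -> J 'X_i) ->
      J (\sum_f c f *: \prod_i a i ^+ f i).
Proof.
move=> lt_e; pose r := (N - #|C|)%N.
have [D hD] : exists D, forall i, degle D (a i).
  exists (\max_i msize (a i)) => i m /msize_mdeg_lt /ltnW /leq_trans; apply.
  exact: (leq_bigmax_cond (F := fun i => msize (a i))).
pose T := ((e * D).+1 ^ r).+1; pose B := (e * T * D).+1; exists T.
have ltBT : (B ^ r < T ^ e)%N.
  have BT : (B <= T * (e * D).+1)%N by rewrite /B /T; nia.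
  have le1 : (B ^ r <= (T * (e * D).+1) ^ r)%N.
    by elim: (r) => // k IH; rewrite !expnS leq_mul.
  apply: (leq_ltn_trans le1); apply: (@leq_trans (T ^ r.+1)); last first.
    by rewrite leq_exp2l // /T ltnS expn_gt0.
  rewrite expnMn expnSr ltn_pmul2l ?expn_gt0 //.
pose F := {ffun 'I_e -> 'I_T}; pose G := pffun_on (ord0 : 'I_B) (~: C) predT.
have cF : #|F| = (T ^ e)%N by rewrite card_ffun !card_ord.
have cG : #|G| = (B ^ r)%N.
  by rewrite card_pffun_on cardsCs setCK !card_ord.
pose mon (g : {ffun 'I_N -> 'I_B}) : 'X_{1..N} := [multinom (g i : nat) | i < N].
pose pw (f : F) := \prod_i a i ^+ f i.
pose A : 'M[K]_(#|F|, #|G|) := \matrix_(i, j) (pw (enum_val i))@_(mon (enum_val j)).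
have /rowV0Pn[v /sub_kermxP vA v0] : kermx A != 0.
  rewrite -mxrank_eq0 mxrank_ker subn_eq0 -ltnNge.
  by apply: leq_ltn_trans (rank_leq_col A) _; rewrite cG cF.
exists (fun f => v 0 (enum_rank f)); split.
  have /rV0Pn[j vj] := v0.
  by exists (enum_val j); rewrite enum_valK.
move=> J iJ JC; apply: (mem_coord_ideal iJ JC) => m mC.
rewrite raddf_sum /=; have [mB|mB] := leqP B (mdeg m).
  rewrite big1 // => f _; rewrite mcoeffZ memN_msupp_eq0 ?mulr0 //.
  apply/negP => mf; suff : (mdeg m <= e * T * D)%N by rewrite leqNgt; move/negP; apply.
  suff : degle (e * T * D) (pw f) by apply.
  have -> : (e * T * D = \sum_(i < e) T * D)%N by rewrite sum_nat_const card_ord mulnA.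
  rewrite /pw; apply: (big_rec2 (fun p k => degle k p)) => [|i k p _ IH].
    exact: degle1.
  apply: degleM IH => m' /(degleX (hD i)) /leq_trans; apply.
  by rewrite leq_mul2r ltnW ?orbT.
have mlt i : (m i < B)%N.
  by apply: leq_ltn_trans mB; rewrite mdegE (bigD1 i) //= leq_addr.
pose g : {ffun 'I_N -> 'I_B} := [ffun i => inord (m i)].
have gG : g \in G.
  apply/pffun_onP; split=> //.
  apply/supportP => i; rewrite inE negbK ffunE => /mC ->.
  by apply: val_inj; rewrite /= inordK.
have mg : mon g = m by apply/mnmP => i; rewrite mnmE ffunE inordK.
have := congr1 (fun M : 'rV_#|G| => M 0 (enum_rank_in gG g)) vA.
rewrite !mxE => e0; rewrite -[RHS]e0 (reindex enum_rank) /=; last first.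
  by apply: onW_bij; exact: enum_rank_bij.
apply: eq_bigr => f _; rewrite mcoeffZ mxE enum_rankK enum_rankK_in // mg.
by [].
Qed.

End Dependence.

(** The numerators of more elements than there are variables outside [C] satisfy
    a relation modulo the variables in [C]; that relation kills [u], which is
    impossible for elements rising through a tower above [u]. *)
Lemma rising_tower_bound (K : fieldType) (N : nat) (C : {set 'I_N})
    (T : comNzRingType) (phi : {rmorphism {mpoly K[N]} -> T})
    (I M : {mpoly K[N]} -> Prop) (d : nat) (J : nat -> T -> Prop)
    (x : nat -> T) (u : T) :
  is_localization phi I M -> rising_tower d J x -> ~ J 0%N u ->
  (forall i, i \in C -> J 0%N (phi 'X_i * u)) ->
  (d <= N - #|C|)%N.
Proof.
move=> [num _ uni] [iJ step] Ju JC; rewrite leqNgt; apply/negP => ltd.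
have ex_num i : exists b s t, phi s * x i = phi b /\ t * phi s = 1.
  have [s [b [Ms e]]] := num (x i).
  by have [t et] := uni s Ms; exists b, s, t.
have [a ha] := choice ex_num.
have tower : rising_tower d J (phi \o a).
  split=> // i id; have [Jsub Jx nx sep] := step i id; split=> //=.
    by have [s [t [<- _]]] := ha i; apply: ideal_propMl => //; apply: iJ.
  move=> b; have [s [t [<- et]]] := ha i => h.
  rewrite -[b]mul1r -et -mulrA; apply: ideal_propMl; first exact/iJ/ltnW.
  by apply: nx; move: h; rewrite mulrCA mulrA.
have [n [c [[f0 cf0] rel]]] := algebraic_dependence (fun i : 'I_d => a i) ltd.
pose A := [set f | c f != 0].
pose e (f : {ffun 'I_d -> 'I_n}) k := if insub k is Some i then f i : nat else 0%N.
have eE f (i : 'I_d) : e f i = f i by rewrite /e valK.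
have /setP /(_ f0) : A = set0; last by rewrite !inE cf0.
apply: (rising_tower_independent (e := e) (c := fun f => phi (c f)%:MP) tower _ _ Ju).
- move=> f; rewrite inE => cf; exists (phi (c f)^-1%:MP).
  by rewrite -rmorphM -mpolyCM mulVf // mpolyC1 rmorph1.
- move=> f f' _ _ eq_e; apply/ffunP => i; apply: val_inj.
  by rewrite /= -!eE; apply: eq_e.
have iJ0 := iJ 0%N (leq0n d).
have iJS : ideal_prop (fun q => J 0%N (phi q * u)).
  split=> [|q q'|b q].
  - by rewrite rmorph0 mul0r; apply: ideal_prop0.
  - by rewrite rmorphD mulrDl; apply: ideal_propD.
  by rewrite rmorphM -mulrA; apply: ideal_propMl.
have := rel _ iJS JC; rewrite rmorph_sum; congr (J 0%N (_ * u)).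
rewrite [RHS]big_mkcond; apply: eq_bigr => f _; rewrite inE -mul_mpolyC rmorphM.
case: eqVneq => [->|_] /=; first by rewrite mpolyC0 rmorph0 mul0r.
congr (_ * _); rewrite rmorph_prod big_mkord; apply: eq_bigr => i _.
by rewrite eE rmorphXn.
Qed.

(** * Prime chains and regular sequences *)

Lemma gen_rcons_adjoin (R : comNzRingType) (s : seq R) x y :
  gen (rcons s x) y <-> adjoin (gen s) x y.
Proof.
by rewrite -gen_cons_adjoin; split; apply: gen_eq => z; rewrite mem_rcons.
Qed.

Lemma gen_take_adjoin (R : comNzRingType) (l s : seq R) i y : (i < size s)%N ->
  gen (l ++ take i.+1 s) y <-> adjoin (gen (l ++ take i s)) s`_i y.
Proof. by move=> h; rewrite -gen_rcons_adjoin (take_nth 0) // rcons_cat. Qed.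

Lemma prime_chain_tower (T : comNzRingType) d : has_prime_chain T d ->
  exists (J : nat -> T -> Prop) (x : nat -> T),
    rising_tower d J x /\ prime_prop (J 0%N).
Proof.
move=> [P hP].
have ex_x i : exists y, (i < d)%N -> y \in (P i.+1 : pred T) /\ y \notin (P i : pred T).
  apply: contrapT => h; have id : (i < d)%N by apply: contrapT => id; apply: h; exists 0.
  have [_ []] := hP i id => y yP; apply: contrapT => /negP yn.
  by apply: h; exists y.
have [x hx] := choice ex_x.
exists (fun i y => y \in (P i : pred T)), x; split; last exact: prime_idealr_prop.
split=> [i _|i id]; first exact: idealr_prop.
have [PS _] := hP i id; have [xS /negbTE xi] := hx i id; split=> // [a|u].
  by rewrite prime_idealrM xi.
move=> /negP/negbTE ui; exists 1; rewrite idealr1; split=> // g.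
by rewrite prime_idealrM ui orbF mulr1.
Qed.

(** Among the [v] that are nonzero modulo [J i] and killed by all that kills [u],
    one with [J i + (v)] maximal is nonzero modulo [x i] as well: if [v = w * x i]
    then [w] is again such an element and generates a larger ideal, so that
    [w = b * v] for some [b], and the unit [1 - b * x i] kills [w]. *)
Lemma regular_sequence_tower (T : comNzRingType) (s : seq T) :
  noetherian T ->
  (forall y, y \in s -> forall r, exists t, t * (1 - r * y) = 1) ->
  regular_sequence s ->
  rising_tower (size s) (fun i => gen (take i s)) (fun i => s`_i).
Proof.
move=> noeT rad [reg _]; split=> [i _|i id]; first exact: gen_ideal.
have iJ := gen_ideal (take i s); have nx : nzd_mod (gen (take i s)) s`_i.
  by move=> a; apply: reg.
have JS y := @gen_take_adjoin T [::] s i y id; rewrite /= in JS.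
split=> // [y /sub_adjoin ?||u Ju]; [exact/JS | exact/JS/adjoin_self |].
have [|v [Jv kv] maxv] := noetherian_max noeT
  (P := fun v => ~ gen (take i s) v /\
                 forall g, gen (take i s) (g * u) -> gen (take i s) (g * v))
  (J := adjoin (gen (take i s))) (fun v _ => adjoin_ideal v iJ).
  by exists u.
exists v; split=> // /JS[w hw]; apply: (Jv).
have kw g : gen (take i s) (g * u) -> gen (take i s) (g * w).
  move=> /kv gv; apply: nx.
  have -> : s`_i * (g * w) = g * v - g * (v - w * s`_i) by ring.
  by apply: ideal_propB => //; apply: ideal_propMl.
have Jw : ~ gen (take i s) w.
  by move=> h; apply: Jv; apply: ideal_propBr hw => //; apply: ideal_propMr.
have [|b hb] := maxv w (conj Jw kw) _ w (adjoin_self w iJ).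
  apply: adjoin_min (adjoin_ideal w iJ) (fun y => @sub_adjoin _ _ w y) _.
  by exists s`_i; rewrite mulrC.
have [t ht] := rad s`_i (mem_nth 0 id) b; case: Jw.
have -> : w = t * ((w - b * v) + b * (v - w * s`_i)).
  by rewrite -[LHS]mul1r -ht; ring.
by apply: ideal_propMl => //; apply: ideal_propD => //; apply: ideal_propMl.
Qed.

Lemma prime_chain_of_regular (T : comNzRingType) (l s : seq T) (P : prime_idealr T) :
  noetherian T ->
  (forall i, (i < size s)%N -> nzd_mod (gen (l ++ take i s)) s`_i) ->
  {subset l ++ s <= (P : pred T)} -> has_prime_chain T (size s).
Proof.
move=> noeT reg lsP.
apply: (prime_chain_of_nzd noeT (J := fun i => gen (l ++ take i s)) (x := fun i => s`_i) (P := P)).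
- by move=> i _; apply: gen_ideal.
- move=> i id; have JS y := gen_take_adjoin l y id.
  by split=> [y /sub_adjoin ?||]; [exact/JS | exact/JS/adjoin_self/gen_ideal | exact: reg].
by rewrite take_size; apply: gen_min (idealr_prop P) lsP.
Qed.

(** * Zariski's lemma *)

Section Zariski.
Variable L : fieldType.

(** Multiply the equation by a power of the leading coefficient. *)
Lemma lead_coef_integral (D : idomainType) (phi : {rmorphism D -> L})
    (p : {poly D}) (x : L) :
  injective phi -> p != 0 -> root (map_poly phi p) x ->
  integralOver phi (phi (lead_coef p) * x).
Proof.
move=> injphi p0 /rootP; set l := lead_coef p.
have l0 : phi l != 0 by rewrite -(rmorph0 phi) (inj_eq injphi) lead_coef_eq0.
have sp : size p = (size p).-1.+1 by rewrite prednK // size_poly_gt0.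
rewrite horner_coef size_map_inj_poly ?rmorph0 // sp big_ord_recr /=.
have -> : (map_poly phi p)`_(size p).-1 = phi l by rewrite coef_map.
case: (size p).-1 => [|k].
  by rewrite big_ord0 add0r mulr1 => /eqP; rewrite (negPf l0).
move=> px; pose q := 'X^(k.+1) + \poly_(i < k.+1) (p`_i * l ^+ (k - i)).
exists q.
  rewrite monicE lead_coefDl ?lead_coefXn // size_polyXn ltnS.
  exact: size_poly.
apply/rootP; rewrite rmorphD /= map_polyXn hornerD hornerXn.
have -> : map_poly phi (\poly_(i < k.+1) (p`_i * l ^+ (k - i))) =
   \poly_(i < k.+1) (phi p`_i * phi l ^+ (k - i)).
  apply/polyP => i; rewrite coef_map !coef_poly /=; case: ifP; rewrite ?rmorph0 //.
  by rewrite rmorphM rmorphXn.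
rewrite horner_poly; set lhs := LHS; have <- := mulr0 (phi l ^+ k).
rewrite -[X in _ = _ * X]px {}/lhs mulrDr mulr_sumr addrC.
congr (_ + _); last by rewrite exprMn exprSr mulrA.
apply: eq_bigr => i _; rewrite coef_map exprMn.
have -> : phi l ^+ k = phi l ^+ (k - i) * phi l ^+ i.
  by rewrite -exprD subnK // -ltnS.
by rewrite /=; ring.
Qed.

(** Clearing denominators in an integral equation for [b / q]. *)
Lemma integral_fraction_dvd (D : idomainType) (phi : {rmorphism D -> L}) (b q : D) z :
  injective phi -> integralOver phi z -> z * phi q = phi b ->
  exists n h, b ^+ n = q * h.
Proof.
move=> injphi [p mp /rootP]; rewrite horner_coef size_map_inj_poly ?rmorph0 //.
have sp : size p = (size p).-1.+1 by rewrite prednK // size_poly_gt0 monic_neq0.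
have lp : (map_poly phi p)`_(size p).-1 = 1.
  by rewrite coef_map -[p`_ _]/(lead_coef p) (monicP mp) /= rmorph1.
rewrite sp big_ord_recr /= lp mul1r.
set n := (size p).-1 => pz ez.
exists n, (- \sum_(i < n) p`_i * b ^+ i * q ^+ (n - i.+1)); apply: injphi.
rewrite mulrN rmorphN rmorphXn -ez; apply/eqP; rewrite -addr_eq0; apply/eqP.
rewrite exprMn; set lhs := LHS; have <- := mul0r (phi q ^+ n).
rewrite -[X in _ = X * _]pz {}/lhs mulrDl addrC; congr (_ + _).
rewrite mulr_suml mulr_sumr rmorph_sum; apply: eq_bigr => i _.
rewrite coef_map !rmorphM !rmorphXn -ez exprMn.
have -> : phi q ^+ n = phi q * phi q ^+ i * phi q ^+ (n - i.+1).
  by rewrite -exprS -exprD subnKC.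
by ring.
Qed.

Lemma poly_dvd_const (D : idomainType) (c h : {poly D}) (e : D) :
  c != 0 -> e != 0 -> (1 + 'X * c) * h <> e%:P.
Proof.
move=> c0 e0 eqh.
have sq : size (1 + 'X * c) = (size c).+1.
  have sX : size ('X * c) = (size c).+1 by rewrite mulrC size_mulX.
  by rewrite addrC size_polyDl ?sX // size_poly1 ltnS size_poly_gt0.
have h0 : h != 0.
  by apply/eqP => h0; move/eqP: eqh; rewrite h0 mulr0 eq_sym polyC_eq0 (negPf e0).
have q0 : 1 + 'X * c != 0 by rewrite -size_poly_eq0 sq.
have := congr1 (fun p : {poly D} => size p) eqh.
rewrite /= size_mul // sq size_polyC e0 /=; move: c0 h0; rewrite -!size_poly_gt0.
by case: (size c) (size h) => [|a] [|b]; rewrite ?addnS.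
Qed.

(** Were [t] transcendental over [D], all other generators would be algebraic
    over [D[t]], hence all of [L] integral over [D[t]] up to denominators from
    [D] and the powers of one [c <> 0].  But [1 + t * c] is prime to all those
    denominators, so that its inverse cannot be such an element. *)
Lemma zariski_lemma (D : idomainType) (phi : {rmorphism D -> L}) (s : seq L) :
  injective phi ->
  (forall X : L -> Prop, (forall d, X (phi d)) -> (forall x, x \in s -> X x) ->
     (forall d, d != 0 -> X (phi d)^-1) ->
     (forall x y, X x -> X y -> X (x + y)) ->
     (forall x y, X x -> X y -> X (x * y)) -> forall x, X x) ->
  forall x, x \in s -> exists2 p : {poly D}, p != 0 & root (map_poly phi p) x.
Proof.
have [n] := ubnP (size s); elim: n => // n IH in D phi s *.
move=> sn injphi gens t ts; apply: contrapT => trt.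
pose psi : {rmorphism {poly D} -> L} := horner_eval t \o map_poly phi.
have psiC d : psi d%:P = phi d by rewrite /psi /= map_polyC /= /horner_eval hornerC.
have psiX : psi 'X = t by rewrite /psi /= map_polyX /horner_eval hornerX.
have psi0 p : psi p = 0 -> p = 0.
  move=> pt; apply/eqP; apply: contrapT => /negP p0; apply: trt.
  by exists p => //; apply/rootP.
have injpsi : injective psi.
  by move=> p q epq; apply/eqP; rewrite -subr_eq0; apply/eqP/psi0; rewrite rmorphB epq subrr.
pose s' := rem t s.
have memP x : x \in s -> x = t \/ x \in s'.
  by rewrite (perm_mem (perm_to_rem ts)) in_cons => /predU1P.
have alg x : x \in s' -> exists2 p : {poly {poly D}}, p != 0 & root (map_poly psi p) x.
  move: x; apply: IH => //.
    by rewrite size_rem //; case: (s) ts sn => // y l _ /=.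
  move=> X X0 Xs Xv XD XM; apply: gens => // [d|x /memP[->|/Xs] //|d d0].
  - by rewrite -psiC.
  - by rewrite -psiX.
  by rewrite -psiC; apply: Xv; rewrite polyC_eq0.
have [c c0 hc] : exists2 c : {poly D}, c != 0 &
    forall x, x \in s' -> integralOver psi (psi c * x).
  elim: (s') alg => [|y l IHl] alg; first by exists 1 => //; rewrite oner_eq0.
  have [|c c0 hc] := IHl; first by move=> x xl; apply: alg; rewrite in_cons xl orbT.
  have [p p0 py] := alg y (mem_head _ _).
  exists (lead_coef p * c); first by rewrite mulf_neq0 ?lead_coef_eq0.
  move=> x; rewrite in_cons rmorphM => /predU1P[->|/hc cx].
    rewrite mulrAC; apply: integral_mul; last exact: integral_id.
    exact: lead_coef_integral.
  by rewrite -mulrA; apply: integral_mul => //; apply: integral_id.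
pose X x := exists k (e : D), e != 0 /\ integralOver psi (psi (c ^+ k * e%:P) * x).
have [|||||k [e [e0 inte]]] := gens X _ _ _ _ _ (psi (1 + 'X * c))^-1.
- move=> d; exists 0%N, 1; rewrite oner_eq0; split=> //.
  by rewrite mul1r rmorph1 mul1r -psiC; apply: integral_id.
- move=> x /memP[->|/hc cx].
    exists 0%N, 1; rewrite oner_eq0; split=> //.
    by rewrite mul1r rmorph1 mul1r -psiX; apply: integral_id.
  by exists 1%N, 1; rewrite oner_eq0 mulr1 expr1.
- move=> d d0; exists 0%N, d; split=> //.
  rewrite mul1r psiC mulfV; first exact: integral1.
  by rewrite -(rmorph0 phi) (inj_eq injphi).
- move=> x y [k [e [e0 ex]]] [l [f [f0 fy]]]; exists (k + l)%N, (e * f).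
  rewrite mulf_neq0 //; split=> //.
  have -> : psi (c ^+ (k + l) * (e * f)%:P) * (x + y) =
      psi (c ^+ l * f%:P) * (psi (c ^+ k * e%:P) * x) +
      psi (c ^+ k * e%:P) * (psi (c ^+ l * f%:P) * y).
    by rewrite exprD polyCM !rmorphM; ring.
  by apply: integral_add; apply: integral_mul => //; apply: integral_id.
- move=> x y [k [e [e0 ex]]] [l [f [f0 fy]]]; exists (k + l)%N, (e * f).
  rewrite mulf_neq0 //; split=> //.
  have -> : psi (c ^+ (k + l) * (e * f)%:P) * (x * y) =
      (psi (c ^+ k * e%:P) * x) * (psi (c ^+ l * f%:P) * y).
    by rewrite exprD polyCM !rmorphM; ring.
  exact: integral_mul.
set q := 1 + 'X * c in inte.
have q0 : psi q != 0.
  apply/eqP => /psi0 /(congr1 (fun p : {poly D} => size p)).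
  rewrite size_poly0 /q addrC size_polyDl ?size_poly1 mulrC size_mulX //.
  by rewrite ltnS size_poly_gt0.
have [|r [h eh]] := integral_fraction_dvd (b := c ^+ k * e%:P) (q := q) injpsi inte.
  by rewrite mulfVK.
(* modulo [q], the factor ['X * c] is [-1], so a power of [e] is divisible by [q] *)
have [g eg] : exists g, ('X * c) ^+ (k * r) = (-1) ^+ (k * r) + q * g.
  elim: (k * r)%N => [|m [g eg]]; first by exists 0; rewrite mulr0 addr0.
  by exists ((-1) ^+ m + g * ('X * c)); rewrite !exprSr eg /q; ring.
set m := (k * r)%N in eg; pose E : {poly D} := (e ^+ r)%:P.
apply: (@poly_dvd_const D c ((-1) ^+ m * ('X ^+ m * h - E * g)) (e ^+ r) c0).
  by rewrite expf_neq0.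
have e1 : 'X ^+ m * (q * h) = ('X * c) ^+ m * E.
  rewrite -eh !exprMn -exprM -/m /E polyC_exp.
  by rewrite mulrA.
have s2 : (-1) ^+ m * (-1) ^+ m = 1 :> {poly D} by rewrite -exprMn mulrNN mulr1 expr1n.
rewrite -/q -/E; transitivity ((-1) ^+ m * ('X ^+ m * (q * h) - E * (q * g))); first by ring.
rewrite e1 eg; transitivity ((-1) ^+ m * (-1) ^+ m * E); first by ring.
by rewrite s2 mul1r.
Qed.

End Zariski.

Section ResidueField.

Lemma field_of_inverses (R : comNzRingType) :
  (forall x : R, x != 0 -> exists y, y * x = 1) ->
  exists (L : fieldType) (f : {rmorphism R -> L}), bijective f.
Proof.
move=> ex_inv.
have ex_inv' (x : R) : exists y, (x != 0 -> y * x = 1) /\ (x = 0 -> y = 0).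
  have [->|x0] := eqVneq x 0; first by exists 0.
  by have [y yx] := ex_inv x x0; exists y; split=> // /eqP; rewrite (negPf x0).
have [inv hinv] := choice ex_inv'.
have mulV : {in [pred x : R | x != 0], left_inverse 1 inv *%R}.
  by move=> x; rewrite inE => /(hinv x).1.
have unitP (x y : R) : y * x = 1 -> [pred x : R | x != 0] x.
  by move=> yx; apply/eqP => x0; move/eqP: yx; rewrite x0 mulr0 eq_sym oner_eq0.
have inv_out : {in [predC [pred x : R | x != 0]], inv =1 id}.
  by move=> x; rewrite !inE negbK => /eqP x0; rewrite x0 (hinv 0).2.
pose U : comUnitRingType := HB.pack_for comUnitRingType (GRing.ComNzRing.sort R)
  (GRing.ComNzRing_hasMulInverse.Build R mulV unitP inv_out).
have fldU : GRing.field_axiom U by move=> x x0.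
pose L : fieldType := HB.pack_for fieldType (GRing.ComUnitRing.sort U)
  (GRing.ComUnitRing_isField.Build U fldU).
exists L, (idfun : {rmorphism R -> R}).
by exists idfun.
Qed.

Lemma maximal_residue_field (R : comNzRingType) (P : idealr R) :
  maximal_ideal P ->
  exists (L : fieldType) (f : {rmorphism R -> L}),
    (forall y, exists x, f x = y) /\ forall x, f x = 0 <-> x \in (P : pred R).
Proof.
move=> maxP; pose Q := {ideal_quot P}.
pose pi : {rmorphism R -> Q} := \pi_Q.
have pi0 x : pi x = 0 <-> x \in (P : pred R).
  by rewrite -(rmorph0 pi) -[x in _ <-> x \in _]subr0 Quotient.idealrBE; split=> /eqP.
have sur (y : Q) : exists x, pi x = y by exists (repr y); exact: reprK.
have [|L [f bijf]] := @field_of_inverses Q.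
  move=> y; have [x <-] := sur y => x0.
  have iP := idealr_prop P.
  have [b hb] : adjoin (fun z => z \in (P : pred R)) x 1.
    apply: contrapT => n1; have iJ := adjoin_ideal x iP.
    move/eqP: x0; apply; apply/pi0; apply: (maxP (mk_ideal iJ n1)).
      by move=> z zP; apply/mk_idealE/sub_adjoin.
    exact/mk_idealE/adjoin_self.
  exists (pi b); rewrite -rmorphM -(rmorph1 pi); apply/eqP.
  by rewrite eq_sym -subr_eq0 -rmorphB; apply/eqP/pi0.
have [g fK gK] := bijf.
exists L, (f \o pi); split=> [y|x].
  by have [x ex] := sur (g y); exists x; rewrite /= ex gK.
rewrite -pi0 /=; split=> [fx|->]; last by rewrite rmorph0.
by apply: (can_inj fK); rewrite fx rmorph0.
Qed.

(** Zariski's lemma speaks of the elements of a generating list; [g] is simply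
    added to the list of the variables. *)
Lemma maximal_ideal_algebraic (K : fieldType) (N : nat) (R : comNzRingType)
    (pi : {rmorphism {mpoly K[N]} -> R}) (P : idealr R) (g : {mpoly K[N]}) :
  (forall y, exists x, pi x = y) -> maximal_ideal P ->
  exists2 p : {poly K}, p \is monic &
    pi (map_poly (@mpolyC N K) p).[g] \in (P : pred R).
Proof.
move=> sur /maximal_residue_field[L [f [surf f0]]].
pose h : {rmorphism {mpoly K[N]} -> L} := f \o pi.
pose phi : {rmorphism K -> L} := h \o @mpolyC N K.
pose s := h g :: [seq h 'X_i | i : 'I_N].
have [X XK Xs _ XD XM y|p p0 pg] := zariski_lemma (s := s) (fmorph_inj phi) _ (mem_head _ _).
  have [z <-] := surf y; have [q <-] := sur z; rewrite -[f _]/(h q).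
  have X0 : X 0 by rewrite -(rmorph0 phi).
  have X1 : X 1 by rewrite -(rmorph1 phi).
  rewrite [q]mpolyE rmorph_sum; apply: big_ind => // m _.
  rewrite -mul_mpolyC rmorphM; apply: (XM); first exact: XK.
  rewrite mpolyXE_id rmorph_prod; apply: big_ind => // i _.
  rewrite rmorphXn; elim: (m i) => [|k IH]; first by rewrite expr0.
  rewrite exprS; apply: (XM) => //; apply: Xs; rewrite in_cons.
  by apply/orP; right; apply: (@map_f _ _ (fun i => h 'X_i)); rewrite mem_enum.
pose c := (lead_coef p)^-1; exists (c *: p).
  by rewrite monicE lead_coefZ mulVf // lead_coef_eq0.
apply/f0; rewrite -[f _]/(h _) -horner_map -map_poly_comp -[(h \o _)]/(phi : K -> L).
by rewrite map_polyZ hornerZ (rootP pg) mulr0.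
Qed.
End ResidueField.

(** * Hilbert's basis theorem *)

(** From any position on, [v] has a minimum: jump from minimum to minimum. *)
Lemma nondecreasing_subsequence (v : nat -> nat) :
  exists s : nat -> nat, {homo s : i j / (i < j)%N} /\
    {homo v \o s : i j / (i <= j)%N}.
Proof.
have ex_min a : exists b, (a <= b)%N /\ forall c, (a <= c)%N -> (v b <= v c)%N.
  have ex : exists k, `[< exists2 b, (a <= b)%N & v b = k >].
    by exists (v a); apply/asboolP; exists a.
  have [k /asboolP[b ab <-] mink] := ex_minnP ex.
  by exists b; split=> // c ac; apply: mink; apply/asboolP; exists c.
have [f hf] := choice ex_min.
pose s := fix s k := if k is k'.+1 then f (s k').+1 else f 0%N.
have sS k : (s k < s k.+1)%N by have [] := hf (s k).+1.
exists s; split; first by apply: homo_ltn => //; apply: ltn_trans.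
apply: homo_leq => // [|k]; first exact: leq_trans.
case: k => [|k] /=; first exact: (hf 0%N).2.
by apply: (hf (s k).+1).2; exact: ltn_trans (sS k) (sS k.+1).
Qed.

(** Pass to a subsequence along which one more coordinate is nondecreasing, for
    each coordinate in turn. *)
Lemma dickson (N : nat) (u : nat -> 'X_{1..N}) :
  exists i j, (i < j)%N /\ (u i <= u j)%MM.
Proof.
suff [s [s_lt s_le]] : exists s : nat -> nat, {homo s : i j / (i < j)%N} /\
    forall c, c \in enum 'I_N -> {homo (fun k => u (s k) c) : i j / (i <= j)%N}.
  exists (s 0%N), (s 1%N); split; first exact: s_lt.
  by apply/mnm_lepP => c; apply: (s_le c _ 0%N 1%N) => //; rewrite mem_enum.
elim: (enum 'I_N) => [|c l [s [s_lt s_le]]]; first by exists id; split=> // c; rewrite in_nil.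
have [t [t_lt t_le]] := nondecreasing_subsequence (fun k => u (s k) c).
exists (s \o t); split=> [i j ij /=|c']; first by apply: s_lt; apply: t_lt.
rewrite in_cons => /predU1P[->|cl]; first exact: t_le.
move=> i j ij; apply: (s_le c' cl).
by move: ij; rewrite leq_eqVlt => /predU1P[->//|/t_lt/ltnW].
Qed.

Section HilbertBasis.
Variables (K : fieldType) (N : nat).
Local Notation S := {mpoly K[N]}.

(** Multivariate division: the leading monomial of [p] is cancelled against the
    element of [l] whose leading monomial divides it. *)
Lemma division_gen (J : S -> Prop) (l : seq S) : ideal_prop J ->
  (forall q, q \in l -> J q) ->
  (forall p, J p -> p != 0 -> exists q, [/\ q \in l, q != 0 & (mlead q <= mlead p)%MM]) ->
  forall p, J p -> gen l p.
Proof.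
move=> iJ lJ div; elim/mleadrect => p IH Jp.
have [->|p0] := eqVneq p 0; first exact: gen0.
have [q [ql q0 qp]] := div p Jp p0.
pose t := (mleadc p / mleadc q) *: 'X_[mlead p - mlead q] * q.
have c0 : mleadc p / mleadc q != 0 by rewrite mulf_neq0 ?invr_eq0 ?mleadc_eq0.
have mt : mlead t = mlead p.
  have X0 m : 'X_[m] != 0 :> S by rewrite -msupp_eq0 msuppX.
  by rewrite /t -scalerAl mleadZ // mleadM // mleadXm submK.
have -> : p = (p - t) + t by rewrite subrK.
apply: genD; last exact/genMl/gen_mem.
have [->|r0] := eqVneq (p - t) 0; first exact: gen0.
apply: IH; last by apply: ideal_propB => //; apply: ideal_propMl => //; apply: lJ.
have le_r : (mlead (p - t) <= mlead p)%O.
  by rewrite (le_trans (mleadB_le _ _)) // mt joinxx.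
rewrite lt_neqAle le_r andbT; apply/eqP => er.
have := mleadc_eq0 (p - t); rewrite (negPf r0) er mcoeffB.
suff -> : t@_(mlead p) = mleadc p by rewrite subrr eqxx.
have -> : t = (mleadc p / mleadc q) *: ('X_[mlead p - mlead q] * q) by rewrite scalerAl.
have := mcoeffMX q (mlead p - mlead q)%MM (mlead q); rewrite submK // => cq.
rewrite mcoeffZ [_ * q]mulrC cq.
by rewrite mulfVK // mleadc_eq0.
Qed.

(** If no finite list suffices for division, then elements can be picked forever
    whose leading monomials are divisible by no earlier one, against [dickson]. *)
Theorem hilbert_basis : noetherian S.
Proof.
move=> I; pose J x := x \in (I : pred S); have iJ := idealr_prop I.
apply: contrapT => nofg.
have ex_next (l : seq S) : exists p, (forall q, q \in l -> J q) ->
    [/\ J p, p != 0 & forall q, q \in l -> q != 0 -> ~~ (mlead q <= mlead p)%MM].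
  apply: contrapT => h; apply: nofg; exists l.
  have lJ q : q \in l -> J q.
    by move=> ql; apply: contrapT => nJ; apply: h; exists 0 => /(_ q ql).
  move=> p; apply/idP/idP => [Jp|]; last exact: (gen_min iJ lJ).
  apply: (division_gen iJ lJ) Jp => {}p Jp p0; apply: contrapT => nq.
  apply: h; exists p => _; split=> // q ql q0; apply/negP => qp.
  by apply: nq; exists q.
have [next hnext] := choice ex_next.
pose l k := iter k (fun l => next l :: l) [::].
have lJ k q : q \in l k -> J q.
  elim: k q => [|k IH] q; first by rewrite in_nil.
  by rewrite /= in_cons => /predU1P[->|/IH //]; have [] := hnext _ IH.
have l_next i j : (i < j)%N -> next (l i) \in l j.
  elim: j => // j IH; rewrite ltnS leq_eqVlt /= in_cons => /predU1P[->|/IH ->].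
    by rewrite eqxx.
  by rewrite orbT.
have [i [j [/l_next ij lead_ij]]] := dickson (fun k => mlead (next (l k))).
have [_ _ /(_ _ ij)] := hnext _ (lJ j).
by have [_ -> _] := hnext _ (lJ i); rewrite lead_ij => /(_ isT).
Qed.

End HilbertBasis.

(** * Regular sequences of polynomials *)

(** The top coefficient of [p * q] not yet accounted for equals one of [q], up to
    coefficients of [q] of higher index: descend from the leading one. *)
Lemma monic_mul_coef_ideal (R : comNzRingType) (J : R -> Prop) (p q : {poly R}) :
  ideal_prop J -> p \is monic -> (forall i, J (p * q)`_i) -> forall i, J q`_i.
Proof.
move=> iJ mp hpq.
suff h n i : (size q <= i + n)%N -> J q`_i by move=> i; apply: (h (size q)); rewrite leq_addl.
elim: n i => [|n IH] i; first by rewrite addn0 => /(nth_default 0) ->; apply: ideal_prop0.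
move=> szq; pose k := (size p).-1.
have pk : p`_k = 1 by rewrite -[LHS]/(lead_coef p) (monicP mp).
have lk : (k < (k + i).+1)%N by rewrite ltnS leq_addr.
have := hpq (k + i)%N; rewrite coefM (bigD1 (Ordinal lk)) //= pk mul1r addKn.
set rest := \sum_(j < _ | _) _; rewrite addrC => h.
rewrite -[q`_i](addKr rest).
apply: ideal_propD => //; apply: ideal_propN => //; apply: ideal_prop_sum => // j nj.
have {nj} /= : (j : nat) != k by [].
rewrite neq_ltn => /orP[jk|kj]; first by apply: ideal_propMl => //; apply: IH; lia.
have spj : (size p <= j)%N := leq_trans (leqSpred _) kj.
by rewrite nth_default // mul0r; apply: ideal_prop0.
Qed.

(** [theta] expands along one variable [t].  It sends the ideal generated by [l] to
    polynomials with coefficients in that ideal, modulo which the monic [theta w]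
    can be cancelled; evaluation at [t] leads back to [R]. *)
Lemma nzd_mod_monic (R : comNzRingType) (theta : {rmorphism R -> {poly R}})
    (t : R) (l : seq R) (w : R) :
  (forall h, (theta h).[t] = h) -> (forall g, g \in l -> theta g = g%:P) ->
  theta w \is monic -> nzd_mod (gen l) w.
Proof.
move=> retr const mw h; have iJ := gen_ideal l.
have coef x : gen l x -> forall i, gen l (theta x)`_i.
  apply: (@gen_min _ l (fun x => forall i, gen l (theta x)`_i)) => [|g gl i]; last first.
    by rewrite const // coefC; case: eqP => _; [apply: gen_mem | apply: gen0].
  split=> [i|u v hu hv i|a u hu i].
  - by rewrite rmorph0 coef0; apply: gen0.
  - by rewrite rmorphD coefD; apply: genD.
  by rewrite rmorphM coefM; apply: ideal_prop_sum => // j _; apply: genMl.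
move=> /coef; rewrite rmorphM => /(monic_mul_coef_ideal iJ mw) hi.
rewrite -[h]retr horner_coef; apply: ideal_prop_sum => // i _.
exact: ideal_propMr.
Qed.

Lemma shift_cancel (R : nzRingType) (u v : R) :
  (u - v)%:P + 'X - ((v - v)%:P + 'X) = (u - v)%:P.
Proof. by rewrite (subrr v) polyC0 add0r addrK. Qed.

Section RegularSequence.
Variables (K : fieldType) (N : nat).
Local Notation S := {mpoly K[N]}.

Definition subst (g : 'I_N -> {poly S}) : {rmorphism S -> {poly S}} :=
  mmap (polyC \o @mpolyC N K) g.

Lemma substX g i : subst g 'X_i = g i.
Proof. by rewrite /subst /= mmapX mmap1U. Qed.

Lemma substC g c : subst g c%:MP = (c%:MP)%:P.
Proof. by rewrite /subst /= mmapC. Qed.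

Lemma subst_retract g t : (forall i, (g i).[t] = 'X_i) -> forall h, (subst g h).[t] = h.
Proof.
move=> gt h; pose f : {rmorphism S -> S} := horner_eval t \o subst g.
rewrite -[LHS]/(f h) [h in RHS]mpolyE [h in LHS]mpolyE rmorph_sum; apply: eq_bigr => m _.
rewrite -mul_mpolyC rmorphM mpolyXE_id rmorph_prod; congr (_ * _).
  by rewrite /f /= /horner_eval substC hornerC.
by apply: eq_bigr => i _; rewrite rmorphXn /f /= /horner_eval substX gt.
Qed.

(** The idempotent [r] encodes a partition of the variables: its fibres are the
    blocks, and its fixed points choose one variable in each. *)
Variable r : 'I_N -> 'I_N.
Hypothesis rr : forall i, r (r i) = r i.
Variable p : 'I_N -> {poly K}.
Hypothesis mp : forall i, p i \is monic.

Definition block_prod (b : 'I_N) : S := \prod_(j | r j == b) 'X_j.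

(** Written in the differences [X_i - X_(r i)] and the representatives [X_(r i)],
    a block product is monic in its representative; polynomials in one difference
    each are therefore independent of the block products. *)
Definition diff_poly (i : 'I_N) : S := (map_poly (@mpolyC N K) (p i)).['X_i - 'X_(r i)].

Lemma subst_diff_poly g i : subst g (diff_poly i) =
  (map_poly polyC (map_poly (@mpolyC N K) (p i))).[g i - g (r i)].
Proof.
rewrite /diff_poly -horner_map -map_poly_comp rmorphB !substX; congr (_.[_]).
by rewrite -map_poly_comp; apply: eq_map_poly => c; rewrite /= -[mmap _ _ _]/(subst g _) substC.
Qed.

(** Substituting [X_b] by the new variable while keeping the differences of its
    block fixed turns the factor [X_j] into ['X + (X_j - X_b)]. *)
Lemma block_prod_nzd (b : 'I_N) (l s : seq 'I_N) : b \notin l -> r b = b ->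
  nzd_mod (gen (map block_prod l ++ map diff_poly s)) (block_prod b).
Proof.
move=> bl rb; pose g j : {poly S} := if r j == b then ('X_j - 'X_b)%:P + 'X else ('X_j)%:P.
apply: (@nzd_mod_monic _ (subst g) 'X_b).
- apply: subst_retract => i; rewrite /g; case: eqP => _; last by rewrite hornerC.
  by rewrite hornerD hornerC hornerX subrK.
- move=> x; rewrite mem_cat => /orP[/mapP[b' b'l ->]|/mapP[i _ ->]].
    rewrite /block_prod !rmorph_prod; apply: eq_bigr => j /eqP rj.
    rewrite substX /g rj; by case: eqP => // eb; rewrite -eb b'l in bl.
  rewrite subst_diff_poly.
  have -> : g i - g (r i) = ('X_i - 'X_(r i))%:P.
    rewrite /g rr; case: eqP => [->|_]; last by rewrite polyCB.
    exact: shift_cancel.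
  by rewrite horner_map.
rewrite /block_prod rmorph_prod; apply: monic_prod => j /eqP rj.
by rewrite substX /g rj eqxx addrC monicXaddC.
Qed.

Lemma diff_poly_nzd0 (i : 'I_N) (s : seq 'I_N) : i \notin s -> r i != i ->
  nzd_mod (gen (map diff_poly s)) (diff_poly i).
Proof.
move=> si ri; pose g j : {poly S} := if j == i then 'X + ('X_(r i))%:P else ('X_j)%:P.
have gr j : g (r j) = ('X_(r j))%:P.
  by rewrite /g; case: eqP => // e; rewrite -e rr eqxx in ri.
apply: (@nzd_mod_monic _ (subst g) ('X_i - 'X_(r i))).
- apply: subst_retract => j; rewrite /g; case: eqP => [->|_]; last by rewrite hornerC.
  by rewrite hornerD hornerC hornerX subrK.
- move=> x /mapP[j js ->]; rewrite subst_diff_poly -horner_map gr /g.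
  by case: eqP => [e|_]; [rewrite -e js in si | rewrite rmorphB].
rewrite subst_diff_poly gr {1}/g eqxx addrK -[_.[_]]/(_ \Po _) comp_polyXr.
exact: monic_map.
Qed.

(** A block product is regular modulo the other elements, so [nzd_mod_swap] lets
    one put the block products in front, one after the other. *)
Lemma diff_poly_nzd (i : 'I_N) (l s : seq 'I_N) : i \notin s -> r i != i ->
  uniq l -> (forall b, b \in l -> r b = b) ->
  nzd_mod (gen (map block_prod l ++ map diff_poly s)) (diff_poly i).
Proof.
move=> si ri; elim: l => [|b l IH]; first by move=> *; apply: diff_poly_nzd0.
rewrite /= => /andP[bl ul] lr.
have rb := lr b (mem_head _ _).
apply: nzd_mod_ext (fun y => iff_sym (gen_cons_adjoin _ _ _)) _.
apply: nzd_mod_swap; first exact: gen_ideal.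
  by apply: IH => // b' b'l; apply: lr; rewrite in_cons b'l orbT.
have := @block_prod_nzd b l (i :: s) bl rb.
apply: nzd_mod_ext => y; rewrite -gen_cons_adjoin.
by split; apply: gen_eq => z; rewrite /= !(in_cons, mem_cat) orbCA.
Qed.

End RegularSequence.

(** * Closed neighborhood ideals *)

Lemma noetherian_image (S R : comNzRingType) (pi : {rmorphism S -> R}) :
  (forall y, exists x, pi x = y) -> noetherian S -> noetherian R.
Proof.
move=> sur noeS I; have iI := idealr_prop I.
have [|s es] := noetherian_fg noeS (J := fun x => pi x \in (I : pred R)).
  split=> [|u v|a u]; first by rewrite rmorph0 idealr0.
    by rewrite rmorphD; apply: rpredD.
  by rewrite rmorphM; apply: idealMr.
exists (map pi s) => y; have [x <-] := sur y; apply/idP/idP => [/es|]; last first.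
  by apply: (gen_min iI) => _ /mapP[z /gen_mem/es Iz ->].
move: x {y}; apply: (@gen_min _ s (fun x => gen (map pi s) (pi x))); last first.
  by move=> z zs; apply/gen_mem/map_f.
split=> [|u v hu hv|a u hu]; first by rewrite rmorph0; apply: gen0.
  by rewrite rmorphD; apply: genD.
by rewrite rmorphM; apply: genMl.
Qed.

Section NonUnits.
Variables (S T : comNzRingType) (phi : {rmorphism S -> T}) (I M : S -> Prop).
Hypothesis pM : prime_prop M.
Hypothesis (locT : is_localization phi I M).

Definition nonunit (y : T) : Prop := ~ exists t, t * y = 1.

Lemma nonunit_num x : nonunit (phi x) <-> M x.
Proof.
split=> [nu|Mx /(loc_unitP pM locT)//]; apply: contrapT => nM.
by apply: nu; have [t et] := loc_unit locT nM; exists t.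
Qed.

Lemma nonunit_prime : prime_prop nonunit.
Proof.
have nuM a y : nonunit y -> nonunit (a * y).
  by move=> nu [t et]; apply: nu; exists (t * a); rewrite -mulrA.
split.
- split=> // [[t]|u v nu nv [t et]].
    by rewrite mulr0 => /eqP; rewrite eq_sym oner_eq0.
  have [s es] := loc_local pM locT nu t; apply: nv; exists (s * t).
  by rewrite -es -et; ring.
- by apply; exists 1; rewrite mulr1.
move=> u v nuv; apply: contrapT => /not_orP[/contrapT[s es] /contrapT[t et]].
by apply: nuv; exists (s * t); rewrite mulrACA es et mulr1.
Qed.

Lemma nonunit_local_ring : local_ring (mk_prime nonunit_prime).
Proof.
have max (J : idealr T) : {subset J <= mk_prime nonunit_prime}.
  move=> y Jy; apply/mk_primeE => -[t ty]; have := idealMr t Jy.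
  by rewrite ty idealr1.
split=> [J _ |J maxJ y]; first exact: max.
by apply/idP/idP; [exact: max | exact: (maxJ (mk_prime nonunit_prime) (max J))].
Qed.

End NonUnits.

Lemma var_nzd (K : fieldType) (N : nat) (i : 'I_N) (l : seq 'I_N) : i \notin l ->
  nzd_mod (gen [seq ('X_j : {mpoly K[N]}) | j <- l]) 'X_i.
Proof.
move=> il; pose g j : {poly {mpoly K[N]}} := if j == i then 'X else ('X_j)%:P.
apply: (@nzd_mod_monic _ (subst g) 'X_i).
- by apply: subst_retract => j; rewrite /g; case: eqP => [->|_]; rewrite ?hornerX ?hornerC.
- move=> x /mapP[j jl ->]; rewrite substX /g; case: eqP => // e.
  by rewrite -e jl in il.
by rewrite substX /g eqxx monicX.
Qed.

Section NeighborhoodIdeal.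
Variables (K : fieldType) (H : simple_graph).
Local Notation S := (graph_ring K H).
Local Notation X := (@vertex_var K H).
Local Notation R := {ideal_quot (NI K H : idealr (graph_ring K H))}.

Definition NI_mem (x : S) : Prop := x \in (NI K H : pred S).

Definition quot_map : {rmorphism S -> R} := \pi_R.

Lemma quot_map_surj (y : R) : exists x, quot_map x = y.
Proof. by exists (repr y); exact: reprK. Qed.

Lemma quot_map_ker x : quot_map x = 0 <-> NI_mem x.
Proof.
rewrite -(rmorph0 quot_map) /NI_mem -[x in _ <-> x \in _]subr0 Quotient.idealrBE.
by split=> /eqP.
Qed.

Lemma NI_ideal : ideal_prop NI_mem. Proof. exact: idealr_prop. Qed.

Definition nbhd_prod (u : H) : S := \prod_(v in closed_nbhd u) X v.

Lemma nbhd_prod_NI u : NI_mem (nbhd_prod u).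
Proof. by apply: gen_mem; apply/mapP; exists u; rewrite // mem_enum. Qed.

Lemma NI_min (J : S -> Prop) : ideal_prop J -> (forall u, J (nbhd_prod u)) ->
  forall x, NI_mem x -> J x.
Proof.
move=> iJ h; apply: (@gen_min _ (NI_generators K H) J iJ) => _ /mapP[u _ ->].
exact: h.
Qed.

Lemma prod_sub_ideal (J : S -> Prop) (A B : {set H}) : ideal_prop J -> A \subset B ->
  J (\prod_(v in A) X v) -> J (\prod_(v in B) X v).
Proof.
move=> iJ /setIidPr AB JA; rewrite (big_setID A) /= AB.
exact: ideal_propMr.
Qed.

Section AtPrime.
Variable P : prime_idealr R.

Definition loc_quot : {rmorphism S -> localization P} := loc_map P \o quot_map.

Definition loc_prime (x : S) : Prop := quot_map x \in (P : pred R).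

Lemma loc_quot_localization : is_localization loc_quot NI_mem loc_prime.
Proof.
exact: (localization_comp quot_map_surj quot_map_ker (loc_map_localization P)).
Qed.

Lemma loc_prime_prime : prime_prop loc_prime.
Proof.
have [iP P1 pP] := prime_idealr_prop P; split=> [||u v].
- split=> [|u v|a u]; first by rewrite /loc_prime rmorph0 idealr0.
    by rewrite /loc_prime rmorphD; apply: rpredD.
  by rewrite /loc_prime rmorphM; apply: idealMr.
- by rewrite /loc_prime rmorph1.
by rewrite /loc_prime rmorphM; apply: pP.
Qed.

Lemma localization_noetherian : noetherian (localization P).
Proof.
exact: (loc_noetherian loc_quot_localization (@hilbert_basis K #|H|)).
Qed.

End AtPrime.

Definition dominating (C : {set H}) : Prop :=
  forall u, exists2 v, v \in closed_nbhd u & v \in C.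

Definition independent (C : {set H}) : Prop :=
  {in C &, forall u v, v \in closed_nbhd u -> v = u}.

(** A dominating set meets every closed neighborhood, hence each generator has a
    factor in it. *)
Lemma NI_sub_dominating (C : {set H}) x : dominating C ->
  NI_mem x -> gen [seq X v | v <- enum C] x.
Proof.
move=> domC; apply: NI_min => [|u]; first exact: gen_ideal.
have [v uv vC] := domC u; rewrite /nbhd_prod (bigD1 v) //=.
by apply: ideal_propMr; [exact: gen_ideal | apply/gen_mem/map_f; rewrite mem_enum].
Qed.

Lemma vertex_var_nzd (v : H) (l : seq H) : v \notin l ->
  nzd_mod (gen [seq X w | w <- l]) (X v).
Proof.
move=> vl; rewrite /vertex_var (map_comp (fun i => 'X_i) enum_rank).
by apply: var_nzd; rewrite mem_map //; exact: enum_rank_inj.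
Qed.

End NeighborhoodIdeal.

(** * Large independent dominating sets *)

Lemma nth_notin_take (A : eqType) (x0 : A) (s : seq A) i : uniq s -> (i < size s)%N ->
  nth x0 s i \notin take i s.
Proof. by move=> us lt; rewrite in_take_leq ?index_uniq ?ltnn // ltnW. Qed.

Lemma gen_nil (R : comNzRingType) (y : R) : gen [::] y -> y = 0.
Proof.
apply: (@gen_min _ [::] (fun y => y = 0)) => [|x]; last by rewrite in_nil.
by split=> // [u v -> ->|a u ->]; rewrite ?addr0 ?mulr0.
Qed.

Section DimensionAndDepth.
Variables (K : fieldType) (H : simple_graph).
Local Notation S := (graph_ring K H).
Local Notation X := (@vertex_var K H).
Local Notation R := {ideal_quot (NI K H : idealr (graph_ring K H))}.
Variable P : prime_idealr R.

(** The variables outside [C] form a regular sequence modulo those in [C]. *)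
Lemma prime_chain_dominating (C : {set H}) : dominating C ->
  (forall v, loc_prime P (X v)) -> has_prime_chain (localization P) #|~: C|.
Proof.
move=> domC XP; have locT := loc_quot_localization P; have pM := loc_prime_prime P.
pose l := [seq X v | v <- enum C]; pose s := [seq X v | v <- enum (~: C)].
have -> : #|~: C| = size (map (loc_quot P) s) by rewrite !size_map cardE.
apply: (@prime_chain_of_regular _ (map (loc_quot P) l) _ (mk_prime (nonunit_prime pM locT))).
- exact: localization_noetherian.
- move=> i; rewrite size_map => lt; rewrite (nth_map 0) // -map_take -map_cat.
  apply: (loc_nzd pM locT) => [x /(NI_sub_dominating domC)|].
    by apply: gen_sub => y yl; rewrite mem_cat yl.
  move: lt; rewrite size_map => lt.
  have v0 : H by case: (enum (~: C)) lt => [|v0 t].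
  rewrite (nth_map v0) // /l /s -map_take -map_cat; apply: vertex_var_nzd.
  rewrite mem_cat negb_or nth_notin_take ?enum_uniq // andbT.
  by have := mem_nth v0 lt; rewrite !mem_enum inE.
- move=> y; rewrite -map_cat => /mapP[x xl ->].
  apply/mk_primeE/(nonunit_num pM locT).
  by move: xl; rewrite mem_cat => /orP[] /mapP[v _ ->]; apply: XP.
Qed.

(** As [C] is independent, the closed neighborhood of a vertex [c] of [C] meets [C]
    in [c] only.  Hence the variables in [C] kill the product [u] of all other
    variables, and a regular sequence rises through a tower above [u], which is
    nonzero because [C] is dominating. *)
Lemma regular_sequence_bound (C : {set H}) (s : seq (localization P)) :
  dominating C -> independent C -> (forall v, v \in C -> loc_prime P (X v)) ->
  {in s, forall y, nonunit y} -> regular_sequence s -> (size s <= #|~: C|)%N.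
Proof.
move=> domC indC XP nus regs.
have locT := loc_quot_localization P; have pM := loc_prime_prime P.
have [iM M1 pM'] := pM; have noeT := @localization_noetherian K H P.
pose u : S := \prod_(v in ~: C) X v.
have cu c : c \in C -> NI_mem (X c * u).
  move=> cC; have -> : X c * u = \prod_(v in c |: ~: C) X v.
    by rewrite big_setU1 // inE cC.
  apply: (prod_sub_ideal (A := closed_nbhd c)); first exact: NI_ideal.
    apply/subsetP => v vc; rewrite !inE; apply/orP.
    case vC: (v \in C); [left | by right].
    by apply/eqP; apply: indC.
  exact: nbhd_prod_NI.
have u0 : loc_quot P u <> 0.
  case: locT => _ zer _ /zer[t [Mt /(NI_sub_dominating domC)]].
  rewrite mulrC => tu; apply: Mt.
  have nzu : nzd_mod (gen [seq X v | v <- enum C]) u.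
    rewrite /u; apply: big_ind => [x|x y|v]; first by rewrite mul1r.
      exact: nzd_modM.
    by rewrite inE => vC; apply: vertex_var_nzd; rewrite mem_enum.
  apply: (gen_min iM _ (nzu _ tu)) => x /mapP[v]; rewrite mem_enum => vC ->.
  exact: XP.
have tower : rising_tower (size s) (fun i => gen (take i s)) (fun i => s`_i).
  apply: regular_sequence_tower => // y /nus ny r.
  exact: (loc_local pM locT ny).
have /(_ (enum_rank @: C) (loc_quot P u)) := rising_tower_bound locT tower.
rewrite card_imset; last exact: enum_rank_inj.
have <- : (#|H| - #|C| = #|~: C|)%N by rewrite [RHS]cardsCs setCK.
apply; first by rewrite take0 => /gen_nil; exact: u0.
move=> _ /imsetP[c cC ->]; rewrite -rmorphM take0.
have -> : loc_quot P ('X_(enum_rank c) * u) = 0.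
  by apply: (loc_sub0 pM locT); apply: cu.
exact: gen0.
Qed.

End DimensionAndDepth.

Section Unmixed.
Variables (K : fieldType) (H : simple_graph).
Local Notation S := (graph_ring K H).
Local Notation X := (@vertex_var K H).
Local Notation R := {ideal_quot (NI K H : idealr (graph_ring K H))}.

Let cst : {rmorphism S -> K} := mcoeff 0%MM.

Let cstX v : cst (X v) = 0.
Proof. by rewrite /cst /= /vertex_var mcoeffX mnm1_eq0. Qed.

Let cst_ideal : ideal_prop (fun x => cst x = 0).
Proof.
split=> [|u v eu ev|a u eu]; first exact: rmorph0.
  by rewrite rmorphD eu ev addr0.
by rewrite rmorphM eu mulr0.
Qed.

Let NI_cst x : NI_mem (H := H) x -> cst x = 0.
Proof.
apply: (NI_min cst_ideal) => u; rewrite /nbhd_prod (bigD1 u) ?inE ?eqxx //=.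
by rewrite rmorphM cstX mul0r.
Qed.

Definition origin_ideal (y : R) : Prop := exists2 x, quot_map K H x = y & cst x = 0.

Lemma origin_quot x : origin_ideal (quot_map K H x) <-> cst x = 0.
Proof.
split=> [[x' e cx']|]; last by exists x.
have : NI_mem (x - x') by apply/quot_map_ker; rewrite rmorphB e subrr.
by move=> /NI_cst; rewrite rmorphB cx' subr0.
Qed.

Lemma origin_prime : prime_prop origin_ideal.
Proof.
have sur := @quot_map_surj K H; split.
- split; first by rewrite -(rmorph0 (quot_map K H)); apply/origin_quot/rmorph0.
    move=> u v [x <- cx] [y <- cy]; rewrite -rmorphD; apply/origin_quot.
    exact: ideal_propD cst_ideal cx cy.
  move=> a u [x <- cx]; have [b <-] := sur a; rewrite -rmorphM; apply/origin_quot.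
  exact: ideal_propMl cst_ideal cx.
- rewrite -(rmorph1 (quot_map K H)) => /origin_quot /eqP.
  by rewrite rmorph1 oner_eq0.
move=> u v; have [x <-] := sur u; have [y <-] := sur v.
rewrite -rmorphM => /origin_quot /eqP; rewrite rmorphM mulf_eq0.
by case/orP=> /eqP e; [left | right]; apply/origin_quot.
Qed.

Lemma origin_maximal : maximal_ideal (mk_prime origin_prime).
Proof.
move=> J PJ y yJ; have iJ := idealr_prop J; have [x ex] := quot_map_surj y.
apply/mk_primeE; rewrite -ex; apply/origin_quot/eqP; apply: contrapT => /negP cx.
have : quot_map K H (cst x)%:MP \in (J : pred R).
  rewrite -[(cst x)%:MP](subrK x) rmorphD ex; apply: (ideal_propD iJ) => //.
  apply/PJ/mk_primeE/origin_quot; rewrite rmorphB.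
  by rewrite {1}/cst /= mcoeffC eqxx mulr1 subrr.
move=> /(idealMr (quot_map K H (cst x)^-1%:MP)).
by rewrite -rmorphM -mpolyCM mulVf // mpolyC1 rmorph1 idealr1.
Qed.

(** At the origin, a small dominating set makes the dimension large and a large
    independent dominating set makes the depth small. *)
Lemma cohen_macaulay_unmixed (C D : {set H}) :
  cohen_macaulay_ideal (NI K H) ->
  dominating C -> dominating D -> independent D -> (#|D| <= #|C|)%N.
Proof.
move=> [_ /(_ _ origin_maximal)[M _ [d [[[s [ss sM regs]] _] [_ chain]]]]].
move=> domC domD indD; set P := mk_prime origin_prime in M s ss sM regs chain *.
have XP v : loc_prime P (X v) by apply/mk_primeE; apply/origin_quot; apply: cstX.
have := chain _ (prime_chain_dominating domC XP).
rewrite -ss => /leq_trans /(_ (regular_sequence_bound domD indD _ _ regs)) le.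
have {le} : (#|~: C| <= #|~: D|)%N.
  apply: le => // y /sM yM [t ty].
  by have := idealMr t yM; rewrite ty idealr1.
have := cardsC C; have := cardsC D; lia.
Qed.

End Unmixed.

(** * Perfect codes *)

Section PerfectCode.
Variables (K : fieldType) (H : simple_graph).
Local Notation S := (graph_ring K H).
Local Notation X := (@vertex_var K H).
Local Notation R := {ideal_quot (NI K H : idealr (graph_ring K H))}.

(** A perfect code, given by the map [f] that sends every vertex to the member of
    the code that dominates it: the closed neighborhoods of the members are the
    fibres of [f].  By [refine] they generate the ideal. *)
Variable f : H -> H.
Hypothesis code : forall u v, (v \in closed_nbhd (f u)) = (f v == f u).
Hypothesis refine : forall v, exists u, closed_nbhd (f u) \subset closed_nbhd v.

Let ff u : f (f u) = f u.
Proof. by apply/eqP; rewrite -code inE eqxx. Qed.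

Section AtMaximal.
Variable P : prime_idealr R.
Hypothesis maxP : maximal_ideal P.

Local Notation phi := (loc_quot P).
Let locT : is_localization phi (NI_mem (H := H)) (loc_prime P).
Proof. exact: loc_quot_localization. Qed.
Let pM : prime_prop (loc_prime P). Proof. exact: loc_prime_prime. Qed.


Lemma prime_nbhd_var (J : S -> Prop) (u : H) : prime_prop J ->
  J (nbhd_prod K (f u)) -> exists2 v, f v = f u & J (X v).
Proof.
move=> [iJ J1 pJ] Ju; apply: contrapT => h.
have : ~ J (nbhd_prod K (f u)).
  rewrite /nbhd_prod; apply: (big_ind (fun x => ~ J x)) => // [x y nx ny /pJ[]//|v].
  by rewrite code => /eqP fv Jv; apply: h; exists v.
exact.
Qed.

Let r (i : 'I_#|H|) : 'I_#|H| := enum_rank (f (enum_val i)).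

Let rr i : r (r i) = r i.
Proof. by rewrite /r enum_rankK ff. Qed.

Let rE i j : (r i == r j) = (f (enum_val i) == f (enum_val j)).
Proof.
by rewrite /r (inj_eq enum_rank_inj).
Qed.

Let block_prodE i : block_prod K r (r i) = nbhd_prod K (f (enum_val i)).
Proof.
rewrite /block_prod /nbhd_prod (reindex (@enum_rank H)) /=; last first.
  by apply: onW_bij; exact: enum_rank_bij.
by apply: eq_bigl => v; rewrite rE enum_rankK code.
Qed.

(* The maximal ideal contains a monic polynomial in each difference. *)
Let ex_p : {p : 'I_#|H| -> {poly K} | forall i, p i \is monic /\
  loc_prime P (diff_poly r p i)}.
Proof.
apply: cid; have h i : exists q : {poly K}, q \is monic /\
    loc_prime P ((map_poly (@mpolyC #|H| K) q).['X_i - 'X_(r i)]).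
  have [q mq qP] := maximal_ideal_algebraic ('X_i - 'X_(r i)) (@quot_map_surj K H) maxP.
  by exists q.
by have [p hp] := choice h; exists p.
Qed.

Let p := sval ex_p.
Let mp i : p i \is monic. Proof. by case: (svalP ex_p i). Qed.
Let Mp i : loc_prime P (diff_poly r p i). Proof. by case: (svalP ex_p i). Qed.

Let reps : seq 'I_#|H| := enum [pred i | r i == i].
Let free : seq 'I_#|H| := enum [pred i | r i != i].
Let fs := map (block_prod K r) reps.
Let ws := map (diff_poly r p) free.

Let repsP i : i \in reps -> r i = i.
Proof. by rewrite mem_enum inE => /eqP. Qed.

Let fs_NI x : x \in fs -> NI_mem x.
Proof.
by move=> /mapP[i /repsP ri ->]; rewrite -ri block_prodE; apply: nbhd_prod_NI.
Qed.

Let NI_fs x : NI_mem x -> gen fs x.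
Proof.
apply: NI_min => [|v]; first exact: gen_ideal.
have [u uv] := refine v; apply: (prod_sub_ideal (gen_ideal fs) uv).
have := block_prodE (enum_rank u); rewrite enum_rankK /nbhd_prod => <-.
by apply/gen_mem/map_f; rewrite mem_enum inE rr.
Qed.

Let gen_phi_fs s y : gen (map phi fs ++ s) y <-> gen s y.
Proof.
split; last by apply: gen_sub => x xs; rewrite mem_cat xs orbT.
apply: gen_min => [|x]; first exact: gen_ideal.
rewrite mem_cat => /orP[/mapP[z /fs_NI zI ->]|]; last exact: gen_mem.
by rewrite (loc_sub0 pM locT zI); apply: gen0.
Qed.

Let maxT := mk_prime (nonunit_prime pM locT).

Let ws_reg i : (i < size ws)%N ->
  nzd_mod (gen (map phi fs ++ take i (map phi ws))) (map phi ws)`_i.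
Proof.
move=> lt; rewrite (nth_map 0) // -map_take -map_cat.
apply: (loc_nzd pM locT) => [x /NI_fs|].
  by apply: gen_sub => y yl; rewrite mem_cat yl.
move: lt; rewrite size_map => lt.
have i0 : 'I_#|H| by case: free lt => [|i0 t].
have fi : nth i0 free i \in free by exact: mem_nth.
rewrite (nth_map i0) // -map_take; apply: (diff_poly_nzd rr mp).
- by rewrite nth_notin_take ?enum_uniq.
- by move: fi; rewrite mem_enum.
- exact: enum_uniq.
exact: repsP.
Qed.

Let ws_max : {subset map phi ws <= (maxT : pred (localization P))}.
Proof.
move=> _ /mapP[_ /mapP[i _ ->] ->].
by apply/mk_primeE; apply/(nonunit_num pM locT); apply: Mp.
Qed.

Let card_free : (#|H| - size reps = size free)%N.
Proof.
rewrite /reps /free -!cardE -[RHS](addKn #|[pred i | r i == i]|).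
congr (_ - _)%N; rewrite -[LHS]card_ord -(cardC [pred i | r i == i]).
by congr (_ + _)%N; apply: eq_card => i; rewrite !inE.
Qed.

Let krull : krull_dim (localization P) (size ws).
Proof.
split.
  have noeT := @localization_noetherian K H P.
  have := @prime_chain_of_regular _ (map phi fs) (map phi ws) maxT noeT.
  rewrite size_map; apply; first exact: ws_reg.
  move=> y; rewrite mem_cat => /orP[/mapP[x /fs_NI xI ->]|]; last exact: ws_max.
  by rewrite (loc_sub0 pM locT xI); exact: idealr0.
move=> e /prime_chain_tower[J [x [tower pJ]]].
have [iJ J1 pJ'] := pJ.
(* every block contributes a variable to the smallest prime of the chain *)
have pJS : prime_prop (fun y : S => J 0%N (phi y)).
  split=> [||u v]; last by rewrite rmorphM; apply: pJ'.
    split=> [|u v hu hv|b u hu]; rewrite ?rmorph0 ?rmorphD ?rmorphM.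
    - exact: ideal_prop0.
    - exact: ideal_propD.
    exact: ideal_propMl.
  by rewrite rmorph1.
have ex_c (i : 'I_#|H|) : exists v, f v = f (enum_val i) /\ J 0%N (phi (X v)).
  have [|v fv Jv] := prime_nbhd_var (u := enum_val i) pJS; last by exists v.
  by rewrite (loc_sub0 pM locT (nbhd_prod_NI K _)); apply: ideal_prop0.
have [c hc] := choice ex_c.
pose C := [set enum_rank (c i) | i in reps].
have cardC : #|C| = size reps.
  rewrite card_in_imset; first by apply/card_uniqP; apply: enum_uniq.
  move=> i j ri rj /enum_rank_inj cij.
  rewrite -(repsP ri) -(repsP rj); apply/eqP; rewrite rE.
  by have [<- _] := hc i; have [<- _] := hc j; rewrite cij.
rewrite size_map -card_free -cardC.
apply: (rising_tower_bound locT tower J1) => _ /imsetP[i _ ->].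
by rewrite mulr1; case: (hc i).
Qed.

Let depthT : depth maxT (size ws).
Proof.
split; last first.
  move=> e [s [<- smax [reg _]]]; apply: krull.2.
  apply: (@prime_chain_of_regular _ [::] s maxT (localization_noetherian (P := P))) => //.
  by move=> i lt b; apply: reg.
exists (map phi ws); split; [by rewrite size_map | exact: ws_max | split].
  move=> i y; rewrite size_map => lt h.
  apply: (proj1 (gen_phi_fs _ _)); apply: ws_reg => //.
  exact: (proj2 (gen_phi_fs _ _)).
apply/negP => /(gen_min (idealr_prop maxT) ws_max).
by rewrite idealr1.
Qed.

(** Modulo the block products, which vanish in the quotient, the [diff_poly]s of
    the maximal ideal form a regular sequence whose length bounds the dimension:
    a prime contains one variable of each block. *)
Lemma perfect_code_local : cohen_macaulay_local (localization P).
Proof.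
exists maxT; first exact: nonunit_local_ring.
by exists (size ws); split; [exact: depthT | exact: krull].
Qed.

End AtMaximal.

Lemma perfect_code_cohen_macaulay : cohen_macaulay_ideal (NI K H).
Proof.
split; last by move=> P maxP; apply: perfect_code_local.
exact: (noetherian_image (@quot_map_surj K H) (@hilbert_basis K #|H|)).
Qed.

End PerfectCode.

(** * The square of a broom *)

Section BroomSquare.
Variables n m : nat.
Local Notation G := (graph_square (broom n.+1 m.+1)).

Lemma broom_nbhdE (u v : G) : v \in closed_nbhd u =
  match u, v with
  | inl _, inl _ => true
  | inl _, inr j | inr j, inl _ => (j < 2)%N
  | inr j, inr k => (k <= j + 2)%N && (j <= k + 2)%N
  end.
Proof.
rewrite inE broom_squareE //; case: u v => [i|j] [i'|k].
- by rewrite -[_ == _ :> G]/(i' == i) eq_sym orbN.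
- by rewrite /=; case: (k : nat) => [|[]].
- by rewrite /=; case: (j : nat) => [|[]].
rewrite -[_ == _ :> G]/(k == j :> nat); lia.
Qed.

Let y (k : nat) : G := inr (inord k : 'I_m.+1).
Let x : G := inl (ord0 : 'I_n.+1).

(** Counting the path from 1, the vertices [2, 7, 12, ...] of the path, the last
    one being pulled back to the end of the path if it overshoots: two vertices of the path are
    adjacent in the square up to distance 2, so that each dominates 5. *)
Definition broom_sparse : {set G} :=
  [set y (minn (5 * k + 1) m) | k : 'I_(m.+1 %/ 5).+1].

(** The vertices [3, 6, 9, ...] of the path are as close as independence allows;
    [x] takes care of the leaves and of the first two vertices of the path. *)
Definition broom_packed : {set G} :=
  x |: [set y (3 * k + 2) | k : 'I_(m.+1 %/ 3)].

Lemma broom_sparse_dominating : (0 < m)%N -> dominating broom_sparse.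
Proof.
move=> m0 u.
pose j := if u is inr j then j : nat else 0%N.
have jm : (j <= m)%N by rewrite /j; case: (u) => // j'; rewrite -ltnS.
have lt : (j.+1 %/ 5 < (m.+1 %/ 5).+1)%N by rewrite ltnS leq_div2r.
exists (y (minn (5 * (j.+1 %/ 5) + 1) m)); last by apply/imsetP; exists (Ordinal lt).
rewrite broom_nbhdE /y; have h : (minn (5 * (j.+1 %/ 5) + 1) m < m.+1)%N by rewrite ltnS geq_minr.
rewrite /j in h *; case: u @j h jm lt => [i|j'] /= h jm _; rewrite inordK //; lia.
Qed.

Lemma broom_sparse_card : (#|broom_sparse| <= (m.+1 %/ 5).+1)%N.
Proof. by rewrite (leq_trans (leq_imset_card _ _)) // card_ord. Qed.

Let packed_lt (k : 'I_(m.+1 %/ 3)) : (3 * k + 2 < m.+1)%N.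
Proof. by have := ltn_ord k; lia. Qed.

Lemma broom_packed_dominating : dominating broom_packed.
Proof.
move=> u; case: u => [i|j].
  by exists x; [rewrite broom_nbhdE | rewrite !inE eqxx].
have [j2|j2] := ltnP j 2; first by exists x; [rewrite broom_nbhdE | rewrite !inE eqxx].
have := ltn_ord j => jm.
have lt : ((j - 2) %/ 3 < m.+1 %/ 3)%N by lia.
exists (y (3 * ((j - 2) %/ 3) + 2)).
  have := packed_lt (Ordinal lt); rewrite broom_nbhdE /y => /inordK -> /=; lia.
by rewrite !inE; apply/orP; right; apply/imsetP; exists (Ordinal lt).
Qed.

Lemma broom_packed_independent : independent broom_packed.
Proof.
move=> u v /setU1P[->|/imsetP[k _ ->]] /setU1P[->|/imsetP[l _ ->]] //.
- by rewrite broom_nbhdE /y /x inordK ?packed_lt //; lia.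
- by rewrite broom_nbhdE /y /x inordK ?packed_lt //; lia.
rewrite broom_nbhdE /y !inordK ?packed_lt // => h.
by have -> : (l : nat) = k by lia.
Qed.

Lemma broom_packed_card : #|broom_packed| = (m.+1 %/ 3).+1.
Proof.
rewrite cardsU1 card_imset ?card_ord.
  by case: imsetP => // -[k _].
move=> k l [] /(congr1 (fun i : 'I_m.+1 => i : nat)).
by rewrite !inordK ?packed_lt // => h; apply: val_inj => /=; lia.
Qed.

End BroomSquare.

Lemma broom_not_unmixed (K : fieldType) (n m : nat) : (1 < n)%N -> (1 < m)%N ->
  cohen_macaulay_ideal (NI K (graph_square (broom n m))) -> (m %/ 3 <= m %/ 5)%N.
Proof.
case: n m => // n [//|m] _ m1 CM; rewrite -ltnS -(broom_packed_card n).
apply: leq_trans (broom_sparse_card n m).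
apply: (cohen_macaulay_unmixed CM).
- exact: broom_sparse_dominating.
- exact: broom_packed_dominating.
exact: broom_packed_independent.
Qed.

(** The square is complete: one vertex is a perfect code. *)
Lemma broom2_cohen_macaulay (K : fieldType) (n : nat) :
  cohen_macaulay_ideal (NI K (graph_square (broom n.+1 2))).
Proof.
apply: (@perfect_code_cohen_macaulay K (graph_square (broom n.+1 2)) (fun=> inl ord0)) => [u v|v].
  rewrite eqxx broom_nbhdE; case: v => // j; exact: ltn_ord.
exists v; apply/subsetP => w _; rewrite broom_nbhdE.
case: v w => [i|j] [i'|k] //; try exact: ltn_ord.
by have := ltn_ord j; have := ltn_ord k; lia.
Qed.

(** A leaf and the last vertex of the path form a perfect code. *)
Lemma broom5_cohen_macaulay (K : fieldType) (n : nat) :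
  cohen_macaulay_ideal (NI K (graph_square (broom n.+1 5))).
Proof.
pose G := graph_square (broom n.+1 5).
have lr : (inl ord0 == inr ord_max :> G) = false by [].
have rl : (inr ord_max == inl ord0 :> G) = false by [].
pose f (v : G) : G :=
  if v is inr j then if (j < 2)%N then inl ord0 else inr ord_max else inl ord0.
apply: (@perfect_code_cohen_macaulay K _ f) => [u v|v].
  rewrite broom_nbhdE; case: u v => [i|j] [i'|k] /=; rewrite ?eqxx //.
  - by case: ltnP.
  - by case: (j < 2)%N.
  case: (ltnP j 2); case: (ltnP k 2) => //= hk _; rewrite ?eqxx ?lr ?rl //; have := ltn_ord k; lia.
exists v; apply/subsetP => w; rewrite !broom_nbhdE.
case: v w => [i|j] [i'|k] //=; case: ltnP => //= hj; try lia.
  by have := ltn_ord j; have := ltn_ord k; lia.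
Qed.

Unset Implicit Arguments.
Local Close Scope quotient_scope.
Local Close Scope ring_scope.

Theorem corollary3p9 (K : fieldType) (n m : nat) (hn : (2 <= n)%N)
    (hm : (2 <= m)%N) :
  cohen_macaulay_ideal (NI K (graph_square (broom n m))) <-> m = 2 \/ m = 5.
Proof.
split=> [CM|].
  by have := broom_not_unmixed hn hm CM; lia.
case: n hn => // n _ [->|->].
  exact: broom2_cohen_macaulay.
exact: broom5_cohen_macaulay.
Qed.
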